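(* Let $\mathbb{A}\subseteq \mathbb{R}\times E^{[\infty]}$ be analytic. Then there are a nonempty perfect set $P\subseteq\mathbb{R}$ and an $X\in E^{[\infty]}$ such that either (i) player I has a strategy $\sigma$ in the asymptotic game $F[X]$ such that $P\times[\sigma]\subseteq(\mathbb{R}\times E^{[\infty]})\setminus\mathbb{A}$, or (ii) for every $t\in P$, player II has a strategy in the Gowers game $G[X]$ for playing into $\mathbb{A}_t=\{Y\in E^{[\infty]}:(t,Y)\in\mathbb{A}\}$.
   Context: $F$ is a countable (possibly finite) field and $E$ is a countably infinite-dimensional $F$-vector space with a fixed basis $(e_n)_{n\in\omega}$. The support $\mathrm{supp}(v)$ of a nonzero $v\in E$ is the finite set of $i$ such that $e_i$ has nonzero coefficient in $v$. A block sequence is a sequence $(x_n)$ of nonzero vectors with $\max\mathrm{supp}(x_n)<\min\mathrm{supp}(x_{n+1})$ for all $n$. $E^{[\infty]}$ is the set of infinite block sequences, topologized as a subspace of $E^\omega$ ($E$ discrete), a Polish space. $\langle X\rangle$ is the linear span of $X$; $Y\preceq X$ means $\langle Y\rangle\subseteq\langle X\rangle$. Asymptotic game $F[X]$ ($X\in E^{[\infty]}$): I plays natural numbers $n_k$, II responds with nonzero $y_k\in\langle X\rangle$ with $n_k<\min\mathrm{supp}(y_k)$, and II's moves must form a block sequence; the outcome is $(y_k)$. Gowers game $G[X]$: I plays $Y_k\in E^{[\infty]}$ with $Y_k\preceq X$, II responds with nonzero $y_k\in\langle Y_k\rangle$, II's moves forming a block sequence; outcome $(y_k)$. A strategy for a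 player is a function from finite sequences of the opponent's previous moves to moves. A player has a strategy for playing into (out of) a set $\mathbb{B}\subseteq E^{[\infty]}$ if all outcomes of plays following the strategy lie in (outside) $\mathbb{B}$. For a strategy $\sigma$ of I, $[\sigma]$ is the set of all outcomes of plays in which I follows $\sigma$. *)

(* Defs.v *)
From Stdlib Require Import Reals.
From mathcomp Require Import all_boot all_algebra.
Set Implicit Arguments. Unset Strict Implicit. Unset Printing Implicit Defensive.
Import GRing.Theory.

Section Vectors.
Variable F : countFieldType.
Local Open Scope ring_scope.

(* Vectors of E are coefficient functions w.r.t. the basis (e_n), with finite
   support: v = sum_i v i * e_i. *)
Definition vec := nat -> F.

Definition finsupp (v : vec) : Prop := exists N : nat, forall n, (N <= n)%N -> v n = 0.

Definition nonzero (v : vec) : Prop := exists i, v i != 0.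

Definition in_supp (v : vec) (i : nat) : Prop := v i != 0.

Definition supp_lt (u v : vec) : Prop :=
  forall i j, in_supp u i -> in_supp v j -> (i < j)%N.

Definition above (n : nat) (v : vec) : Prop := forall i, in_supp v i -> (n < i)%N.

Definition block_seq (X : nat -> vec) : Prop :=
  forall k, finsupp (X k) /\ nonzero (X k) /\ supp_lt (X k) (X k.+1).

Definition in_span (X : nat -> vec) (v : vec) : Prop :=
  exists (n : nat) (c : nat -> F), forall i, v i = \sum_(k < n) c k * X k i.

Definition preceq (Y X : nat -> vec) : Prop := forall k, in_span X (Y k).

(* [sigma] for a strategy sigma of player I in the asymptotic game F[X]:
   sigma maps the finite sequence of II's previous moves to a natural number;
   an outcome is a sequence (y_k) of legal moves of II, i.e. a block sequence
   of nonzero vectors of <X> with sigma(y_0..y_{k-1}) < min supp y_k. *)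
Definition asym_outcomes (X : nat -> vec) (sigma : seq vec -> nat) (Y : nat -> vec) : Prop :=
  block_seq Y /\ (forall k, in_span X (Y k)) /\ (forall k, above (sigma (mkseq Y k)) (Y k)).

(* Player II has a strategy in the Gowers game G[X] for playing into B:
   tau maps the finite sequence (Y_0,...,Y_k) of I's moves to II's answer y_k;
   against every legal sequence of moves of I (Y_k in E^[infty], Y_k ≼ X),
   II's answers are legal (nonzero, in <Y_k>, forming a block sequence)
   and the outcome lies in B. *)
Definition II_gowers_into (X : nat -> vec) (B : (nat -> vec) -> Prop) : Prop :=
  exists tau : seq (nat -> vec) -> vec,
    forall Ys : nat -> (nat -> vec),
      (forall k, block_seq (Ys k) /\ preceq (Ys k) X) ->
      let y := fun k => tau (mkseq Ys k.+1) in
      (forall k, in_span (Ys k) (y k)) /\ block_seq y /\ B y.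

End Vectors.

Section Reals_part.
Local Open Scope R_scope.

Definition nonempty_perfect (P : R -> Prop) : Prop :=
  (exists x, P x) /\
  (forall x, (forall eps, 0 < eps -> exists y, P y /\ Rabs (y - x) < eps) -> P x) /\
  (forall x, P x -> forall eps, 0 < eps -> exists y, P y /\ y <> x /\ Rabs (y - x) < eps).

(* continuity of f : N^N -> R x E^omega (product topologies, N and E discrete) *)
Definition baire_continuous {T : Type} (f : (nat -> nat) -> R * (nat -> T)) : Prop :=
  forall (a : nat -> nat) (eps : R) (n : nat), 0 < eps ->
    exists m : nat, forall b : nat -> nat,
      (forall i, (i < m)%nat -> b i = a i) ->
      Rabs (fst (f b) - fst (f a)) < eps /\
      (forall i, (i < n)%nat -> snd (f b) i = snd (f a) i).

Definition analytic {T : Type} (A : R * (nat -> T) -> Prop) : Prop :=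
  (forall p, ~ A p) \/
  exists f : (nat -> nat) -> R * (nat -> T),
    baire_continuous f /\ forall p, A p <-> exists a, f a = p.

End Reals_part.

(* Main.v *)
From Stdlib Require Import Reals Lra Classical ClassicalEpsilon FunctionalExtensionality.
From Stdlib Require Import PropExtensionality.
From mathcomp Require Import all_boot all_algebra.
Require Import Defs.
(** Parameters are first coded in Cantor space, where we work with conditions
    [(q, Y)], [q] a perfect set and [Y] a block sequence, and with fusion of
    such conditions; a homeomorphic copy of Cantor space inside the line
    transfers the result to reals.

    Write [A] as the projection of a closed set with witnesses in Baire space
    and let [A_s] be the part of [A] with witness extending the finite sequence
    [s].  By fusion, for every finite block sequence [x] and every [s], either I
    has one strategy avoiding [(A_s)_t] from [x] on for all [t] near a given
    one, or no smaller condition has such a strategy: [(x, s)] is then bad at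
    [t].  From a bad position II can reach in the Gowers game, for each [t]
    separately, a longer bad position with one more digit of the witness.
    Otherwise the dichotomy for open games gives a strategy of I, uniform in
    [t], leading to good positions only, and I can follow the strategies
    attached to the positions met, taking up one digit per move.  If the
    initial position is bad, II thus produces infinitely many digits, and by
    continuity they witness that the outcome is in [A_t].

    The dichotomy for open games requires the uniform version of a trivial
    alternative: given sets [G_t] of vectors varying continuously with [t],
    either some [Y] avoids [G_t] for all [t] in a perfect set, or there is a
    condition below which no [V] avoids any [G_t].  This is a fusion building
    the vectors of [Y] and the perfect set at the same time; at each step, a
    vector suitable for all nodes of the current level is found because
    avoiding sets of different [t] can be chosen one inside the other. *)

Set Implicit Arguments.
Unset Strict Implicit.
Unset Printing Implicit Defensive.

(** * Choice principles *)

Lemma choice_fun (S T : Type) (R : S -> T -> Prop) :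
  (forall x, exists y, R x y) -> exists f, forall x, R x (f x).
Proof.
move=> H; exists (fun x => proj1_sig (constructive_indefinite_description _ (H x))).
by move=> x; case: constructive_indefinite_description.
Qed.

Lemma dependent_choice (S : Type) (P : S -> Prop) (R : S -> S -> Prop) s0 :
  P s0 -> (forall s, P s -> exists s', P s' /\ R s s') ->
  exists st : nat -> S, st 0 = s0 /\ forall n, P (st n) /\ R (st n) (st n.+1).
Proof.
move=> P0 H.
have [f Hf] : exists f, forall s, P s -> P (f s) /\ R s (f s).
  apply: (choice_fun (R := fun s s' => P s -> P s' /\ R s s')) => s.
  have [Ps|nPs] := classic (P s); last by exists s.
  by have [s' Hs'] := H s Ps; exists s'.
have Pn n : P (iter n f s0) by elim: n => //= n /Hf[].
by exists (fun n => iter n f s0); split=> // n; split=> //=; case: (Hf _ (Pn n)).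
Qed.

(** * Perfect subsets of Cantor space *)

Definition agree (n : nat) (t t' : nat -> bool) := forall i, i < n -> t i = t' i.

Definition subset_of (T : Type) (p q : T -> Prop) := forall t, p t -> q t.

Definition perfect (p : (nat -> bool) -> Prop) :=
  [/\ exists t, p t,
      forall t, (forall n, exists t', p t' /\ agree n t t') -> p t &
      forall t, p t -> forall n, exists t', [/\ p t', agree n t t' & exists i, t i <> t' i]].

Definition cyl (p : (nat -> bool) -> Prop) (t : nat -> bool) (n : nat) :=
  fun t' => p t' /\ agree n t t'.

Lemma agree_sym n t t' : agree n t t' -> agree n t' t.
Proof. by move=> H i /H. Qed.

Lemma agree_trans n u t v : agree n t u -> agree n u v -> agree n t v.
Proof. by move=> H K i ltin; rewrite H // K. Qed.

Lemma agree_le m n t t' : m <= n -> agree n t t' -> agree m t t'.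
Proof. by move=> lemn H i ltim; apply: H; apply: leq_trans ltim lemn. Qed.

Lemma set_eq (T : Type) (p q : T -> Prop) : (forall t, p t <-> q t) -> p = q.
Proof.
by move=> H; apply: functional_extensionality => t; apply: propositional_extensionality.
Qed.

Lemma cyl_sub p t n : subset_of (cyl p t n) p. Proof. by move=> t' []. Qed.

Lemma cyl_self (p : (nat -> bool) -> Prop) t n : p t -> cyl p t n t.
Proof. by []. Qed.

Lemma cyl_mono p q t m n : m <= n -> subset_of p q -> subset_of (cyl p t n) (cyl q t m).
Proof. by move=> lemn spq t' [/spq qt' /(agree_le lemn)]. Qed.

Lemma cyl_recenter p t t' m n : m <= n -> agree m t t' -> subset_of (cyl p t' n) (cyl p t m).
Proof. by move=> lemn a u [pu /(agree_le lemn) b]; split=> //; apply: agree_trans a b. Qed.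

Lemma cyl_eq p t t' n : agree n t t' -> cyl p t n = cyl p t' n.
Proof.
move=> a; apply: set_eq => u; split; apply: cyl_recenter => //.
exact: agree_sym.
Qed.

(** On [p], membership in [K] is decided by the first [m] bits: limits inherit it from close
    approximations, and a second branch that separates beyond level [m] keeps it. *)
Lemma perfect_clopen p (K : (nat -> bool) -> Prop) m :
  perfect p -> (forall t t', p t -> p t' -> agree m t t' -> K t -> K t') ->
  (exists t, p t /\ K t) ->
  perfect (fun t => p t /\ K t).
Proof.
move=> [_ pcl psp] HK ex; split=> // [t H|t [pt Kt] n].
  have pt : p t by apply: pcl => n; have [t' [[pt' _] a]] := H n; exists t'.
  split=> //; have [t' [[pt' Kt'] a]] := H m.
  exact: HK pt' pt (agree_sym a) Kt'.
have [t' [pt' a d]] := psp t pt (maxn n m).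
exists t'; split=> //; last by apply: agree_le a; rewrite leq_maxl.
by split=> //; apply: HK pt pt' _ Kt; apply: agree_le a; rewrite leq_maxr.
Qed.

Lemma perfect_cyl p t n : perfect p -> p t -> perfect (cyl p t n).
Proof.
move=> pp pt; apply: (@perfect_clopen _ _ n) => //; last by exists t.
by move=> u v _ _ a b; apply: agree_trans b a.
Qed.

Definition set_bit (t : nat -> bool) (m : nat) (b : bool) : nat -> bool :=
  fun i => if i == m then b else t i.

Lemma agree_set_bit m t t' b : agree m t t' -> agree m.+1 (set_bit t m b) (set_bit t' m b).
Proof.
move=> H i; rewrite ltnS leq_eqVlt /set_bit; case: eqP => //= _; exact: H.
Qed.

(* There are only finitely many nodes of level [m], so requirements that
   depend on a node can be met one node after the other. *)
Lemma all_nodes (T : Type) (le : T -> T -> Prop) (m : nat) (P : (nat -> bool) -> T -> Prop) :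
  (forall a, le a a) -> (forall b a c, le a b -> le b c -> le a c) ->
  (forall t t' a, agree m t t' -> P t a -> P t' a) ->
  (forall t a b, le a b -> P t a -> P t b) ->
  (forall t a, exists b, le a b /\ P t b) ->
  forall a, exists b, le a b /\ forall t, P t b.
Proof.
move=> le_refl le_trans; elim: m P => [|m IH] P Pinv Pmono Pex a.
  have [b [ab Pb]] := Pex (fun=> true) a; exists b; split=> // t.
  by apply: Pinv Pb => i; rewrite ltn0.
pose P' t b := P (set_bit t m true) b /\ P (set_bit t m false) b.
have [|||b [ab P'b]] := IH P' _ _ _ a.
- by move=> t t' b /agree_set_bit H [P1 P2]; split; [apply: Pinv P1|apply: Pinv P2]; apply: H.
- by move=> t b c bc [P1 P2]; split; [apply: Pmono P1|apply: Pmono P2].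
- move=> t b; have [c [bc P1]] := Pex (set_bit t m true) b.
  have [d [cd P2]] := Pex (set_bit t m false) c.
  by exists d; split; [apply: le_trans bc cd|split=> //; apply: Pmono P1].
exists b; split=> // t; have [P1 P2] := P'b t.
have e : agree m.+1 (set_bit t m (t m)) t.
  by move=> i _; rewrite /set_bit; case: eqP => [->|].
by apply: (Pinv _ _ _ e); case: (t m).
Qed.

(** Finiteness in place of compactness: [P] passes to larger bounds, so the maximum of the bounds
    over the finitely many nodes of level [m] serves for all of them. *)
Lemma node_bound (m : nat) (q : (nat -> bool) -> Prop)
    (P : ((nat -> bool) -> Prop) -> nat -> Prop) :
  (forall p a b, a <= b -> P p a -> P p b) ->
  (forall t, q t -> exists a, P (cyl q t m) a) ->
  exists a, forall t, q t -> P (cyl q t m) a.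
Proof.
move=> Pmono Pex.
(* Nodes that miss [q] carry no requirement, since bounds are only given at points of [q]. *)
pose P' t a := (exists t', cyl q t m t') -> P (cyl q t m) a.
have [|||||a [_ Ha]] := @all_nodes _ leq m P' _ _ _ _ _ 0.
- by [].
- by move=> b a c; apply: leq_trans.
- by move=> t t' a e; rewrite /P' (cyl_eq q e).
- by move=> t a b ab Pa ex; apply: Pmono ab (Pa ex).
- move=> t a; have [[t' [qt' e]]|nex] := classic (exists t', cyl q t m t'); last by exists a; split.
  have [b Pb] := Pex t' qt'; exists (maxn a b); rewrite leq_maxl; split=> // _.
  by rewrite (cyl_eq q e); apply: Pmono Pb; rewrite leq_maxr.
by exists a => t qt; apply: Ha; exists t.
Qed.

Lemma splitting_level p m : perfect p ->
  exists M, m < M /\ forall t, p t -> exists t', [/\ p t', agree m t t' & ~ agree M t t'].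
Proof.
move=> [_ _ psp].
pose P (c : (nat -> bool) -> Prop) M := exists t1 t2, [/\ c t1, c t2 & ~ agree M t1 t2].
have [||M HM] := @node_bound m p P.
- by move=> c a b ab [t1 [t2 [c1 c2 na]]]; exists t1, t2; split=> // /(agree_le ab).
- move=> t pt; have [t' [pt' a [i d]]] := psp t pt m.
  by exists i.+1, t, t'; split=> // H; apply: d; apply: H.
(* [t1] and [t2] separate before [M], so [t] cannot agree with both of them. *)
exists (maxn m.+1 M); rewrite leq_maxl; split=> // t pt.
have [t1 [t2 [[p1 a1] [p2 a2] na]]] := HM t pt.
have [e1|ne1] := classic (agree (maxn m.+1 M) t t1); last by exists t1.
have [e2|ne2] := classic (agree (maxn m.+1 M) t t2); last by exists t2.
case: na; apply: (@agree_le _ (maxn m.+1 M)); first by rewrite leq_maxr.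
by apply: agree_trans (agree_sym e1) e2.
Qed.

(** A branch of [r n] is prolonged through all later stages without changing its first [M n] bits,
    and its limit lies in every stage by closedness. Hence the splittings produced at each stage
    survive in the intersection. *)
Lemma perfect_fusion (r : nat -> (nat -> bool) -> Prop) (M : nat -> nat) :
  (forall n, perfect (r n)) ->
  (forall n, subset_of (r n.+1) (r n)) -> (forall n, M n < M n.+1) ->
  (forall n t, r n t -> exists t', r n.+1 t' /\ agree (M n) t t') ->
  (forall n t, r n.+1 t ->
     exists t', [/\ r n.+1 t', agree (M n) t t' & ~ agree (M n.+1) t t']) ->
  perfect (fun t => forall n, r n t).
Proof.
move=> rp rsub Mlt rkeep rsplit.
have Mle m n : m <= n -> M m <= M n.
  elim: n => [|n IH]; first by rewrite leqn0 => /eqP->.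
  rewrite leq_eqVlt => /orP[/eqP-> //|]; rewrite ltnS => /IH H.
  by apply: leq_trans H (ltnW (Mlt n)).
have Mid n : n <= M n by elim: n => // n IH; apply: leq_ltn_trans IH (Mlt n).
have rle m n : m <= n -> subset_of (r n) (r m).
  elim: n => [|n IH]; first by rewrite leqn0 => /eqP->.
  rewrite leq_eqVlt => /orP[/eqP-> //|]; rewrite ltnS => /IH H t /rsub; exact: H.
have ext n t : r n t -> exists t', (forall k, r k t') /\ agree (M n) t t'.
  move=> rt.
  pose S := (nat * (nat -> bool))%type.
  have [|[k u] /= ru|st [st0 Hst]] := @dependent_choice S (fun s => r s.1 s.2)
      (fun s s' => s'.1 = s.1.+1 /\ agree (M s.1) s.2 s'.2) (n, t) => //=.
    by have [u' [ru' a]] := rkeep _ _ ru; exists (k.+1, u').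
  have st1 k : (st k).1 = n + k.
    elim: k => [|k IH]; first by rewrite st0 addn0.
    by have [_ [-> _]] := Hst k; rewrite IH addnS.
  have ag k l : agree (M (n + k)) (st k).2 (st (k + l)).2.
    elim: l => [|l IH]; first by rewrite addn0.
    rewrite addnS; apply: agree_trans IH _.
    have [_ [_ a]] := Hst (k + l); apply: agree_le a.
    by rewrite st1; apply: Mle; rewrite addnA leq_addr.
  (* Diagonal limit: bit [i] is fixed from step [i.+1] on, because [M (n + i.+1)] exceeds [i]. *)
  pose v i := (st i.+1).2 i.
  have agv k : agree (M (n + k)) (st k).2 v.
    move=> i lti; rewrite /v; have [lk|lk] := leqP k i.+1.
      by rewrite -(subnKC lk); apply: ag.
    rewrite -[in LHS](subnKC (ltnW lk)) -(ag i.+1 (k - i.+1)) //.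
    by apply: leq_trans (Mid _); rewrite addnS ltnS leq_addl.
  exists v; split; last by have := agv 0; rewrite addn0 st0.
  move=> k; have [_ cl _] := rp k; apply: cl => m.
  exists (st (k + m)).2; split.
    have [Hr _] := Hst (k + m); apply: rle Hr.
    by rewrite st1 addnCA leq_addr.
  apply: agree_sym; apply: agree_le (agv _).
  by apply: leq_trans (Mid _); rewrite addnA leq_addl.
split.
- have [[t r0t] _ _] := rp 0; have [t' [rt' _]] := ext 0 t r0t; by exists t'.
- move=> t H n; have [_ cl _] := rp n; apply: cl => m.
  by have [t' [rt' a]] := H m; exists t'.
- move=> t rt n; have [t' [rt' a na]] := rsplit n t (rt n.+1).
  have [v [rv av]] := ext _ _ rt'.
  exists v; split=> //.
    apply: agree_trans (agree_le (Mid n) a) _.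
    by apply: agree_le av; apply: leq_trans (Mid _) (Mle _ _ (leqnSn n)).
  apply: NNPP => H; apply: na => i lti; rewrite av //.
  by apply: NNPP => d; apply: H; exists i.
Qed.

(** * Block sequences *)

Section BlockSequences.
Variable F : countFieldType.
Import GRing.Theory.
Local Open Scope ring_scope.
Implicit Types (X Y Z : nat -> vec F) (u v w y : vec F) (x : seq (vec F)).

Definition zero_vec : vec F := fun _ => 0.

Definition lin (c : F) u v : vec F := fun i => c * u i + v i.

Definition tail (n : nat) X : nat -> vec F := fun k => X (n + k)%N.

(* [Y] is almost below [X]: the spans are nested up to small vectors. *)
Definition almost_le Y X := exists n, forall v, in_span Y v -> above n v -> in_span X v.

Lemma in_span_pad X v : in_span X v ->
  exists n (c : nat -> F), forall N, (n <= N)%N -> forall i, v i = \sum_(k < N) c k * X k i.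
Proof.
move=> [n [c H]]; exists n, (fun k => if (k < n)%N then c k else 0) => N leN i.
rewrite H (big_ord_widen N (fun k => c k * X k i)) // big_mkcond /=.
by apply: eq_bigr => k _; case: ifP; rewrite // mul0r.
Qed.

Lemma in_span_zero X : in_span X zero_vec.
Proof. by exists 0%N, (fun=> 0) => i; rewrite big_ord0. Qed.

Lemma in_span_lin X c u v : in_span X u -> in_span X v -> in_span X (lin c u v).
Proof.
move=> /in_span_pad[n [a Ha]] /in_span_pad[m [b Hb]].
exists (maxn n m), (fun k => c * a k + b k) => i.
rewrite /lin (Ha (maxn n m)) ?leq_maxl // (Hb (maxn n m)) ?leq_maxr //.
rewrite big_distrr -big_split /=; apply: eq_bigr => k _.
by rewrite mulrDl mulrA.
Qed.

Lemma in_span_elem X k : in_span X (X k).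
Proof.
exists k.+1, (fun j => (j == k)%:R) => i.
rewrite big_ord_recr /= eqxx mul1r big1 ?add0r // => j _.
by rewrite ltn_eqF ?mul0r.
Qed.

Lemma in_span_trans X Y v : (forall k, in_span X (Y k)) -> in_span Y v -> in_span X v.
Proof.
move=> H [n [c Hv]].
have -> : v = (fun i => \sum_(k < n) c k * Y k i) by apply: functional_extensionality.
elim: n {Hv} => [|n IH].
  have -> : (fun i => \sum_(k < 0) c k * Y k i) = zero_vec; last exact: in_span_zero.
  by apply: functional_extensionality => i; rewrite big_ord0.
have -> : (fun i => \sum_(k < n.+1) c k * Y k i) =
          lin (c n) (Y n) (fun i => \sum_(k < n) c k * Y k i).
  by apply: functional_extensionality => i; rewrite big_ord_recr /= /lin addrC.
exact: in_span_lin.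
Qed.

Lemma block_lt X j k : block_seq X -> (j < k)%N -> supp_lt (X j) (X k).
Proof.
move=> bX; elim: k => // k IH; rewrite ltnS leq_eqVlt => /orP[/eqP->|/IH H].
  by have [_ [_ ]] := bX k.
move=> a b Xa Xb; have [_ [[c Xc] Hk]] := bX k.
exact: ltn_trans (H _ _ Xa Xc) (Hk _ _ Xc Xb).
Qed.

Lemma block_above X k i : block_seq X -> in_supp (X k) i -> (k <= i)%N.
Proof.
move=> bX; elim: k i => // k IH i Xi.
have [_ [[c Xc] H]] := bX k; exact: leq_ltn_trans (IH _ Xc) (H _ _ Xc Xi).
Qed.

Lemma in_span_finsupp X v : block_seq X -> in_span X v -> finsupp v.
Proof.
move=> bX [n [c H]].
have [N HN] : exists N, forall k, (k < n)%N -> forall i, (N <= i)%N -> X k i = 0.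
  elim: n {H} => [|n [N HN]]; first by exists 0%N.
  have [[N' HN'] _] := bX n; exists (maxn N N') => k; rewrite ltnS leq_eqVlt.
  by case/orP=> [/eqP->|ltk] i; rewrite geq_max => /andP[l1 l2]; [apply: HN'|apply: HN].
exists N => i leN; rewrite H big1 // => k _.
by rewrite HN ?mulr0.
Qed.

Lemma block_bounded X n : block_seq X ->
  exists N, forall k, (k < n)%N -> forall i, in_supp (X k) i -> (i <= N)%N.
Proof.
move=> bX; elim: n => [|n [N HN]]; first by exists 0%N.
have [[N' HN'] _] := bX n; exists (maxn N N') => k; rewrite ltnS leq_eqVlt => /orP[/eqP->|ltk] i Xi.
  rewrite leq_max; apply/orP; right; rewrite leqNgt; apply/negP => lt.
  by move: Xi; rewrite /in_supp HN' ?eqxx // ltnW.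
by rewrite leq_max (HN _ ltk).
Qed.

(* A coefficient of [v] on an early [X k] would put the support of [X k] inside
   that of [v]. *)
Lemma in_span_tail X n : block_seq X ->
  exists N, forall v, in_span X v -> above N v -> in_span (tail n X) v.
Proof.
move=> bX; have [N HN] := block_bounded n bX; exists N => v /in_span_pad[m [c H]] av.
have Hv := H (n + m)%N (leq_addl _ _).
have c0 k : (k < n)%N -> c k = 0.
  move=> ltk; apply/eqP/negP => /negP nz.
  have [_ [[i Xi] _]] := bX k.
  suff Hi : in_supp v i by have := av _ Hi; rewrite ltnNge (HN _ ltk).
  have ltk' : (k < n + m)%N by rewrite ltn_addr.
  rewrite /in_supp Hv (bigD1 (Ordinal ltk')) //= big1 ?addr0 ?mulf_neq0 // => j njk.
  have [->|Xj] := eqVneq (X j i) 0; first by rewrite mulr0.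
  case: (ltngtP j k) => [lt|lt|e].
  - by have := block_lt bX lt Xj Xi; rewrite ltnn.
  - by have := block_lt bX lt Xi Xj; rewrite ltnn.
  - by case/eqP: njk; apply: val_inj.
exists m, (fun k => c (n + k)%N) => i; rewrite Hv big_split_ord /= big1 ?add0r //.
by move=> k _; rewrite c0 ?mul0r.
Qed.

Lemma above_le m n v : (m <= n)%N -> above n v -> above m v.
Proof. by move=> le H i /H; apply: leq_ltn_trans. Qed.

Lemma in_span_above X n : block_seq X ->
  exists y, [/\ in_span X y, nonzero y, finsupp y & above n y].
Proof.
move=> bX; exists (X n.+1); have [fX [nX _]] := bX n.+1.
by split=> //; [apply: in_span_elem|move=> i /(block_above bX)].
Qed.

Lemma finsupp_above v : finsupp v -> exists N, forall w, above N w -> supp_lt v w.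
Proof.
move=> [N HN]; exists N => w aw i j vi wj.
apply: leq_ltn_trans (aw _ wj); rewrite leqNgt; apply/negP => lt.
by move: vi; rewrite /in_supp HN ?eqxx // ltnW.
Qed.

Lemma almost_le_refl X : almost_le X X. Proof. by exists 0%N. Qed.

Lemma almost_le_trans Y X Z : almost_le X Y -> almost_le Y Z -> almost_le X Z.
Proof.
move=> [n H] [m K]; exists (maxn n m) => v Xv av.
by apply: K; [apply: H|]; [|apply: above_le av|apply: above_le av]; rewrite // ?leq_maxl ?leq_maxr.
Qed.

Lemma almost_le_preceq Y X : preceq Y X -> almost_le Y X.
Proof. by move=> H; exists 0%N => v Yv _; apply: in_span_trans Yv. Qed.

(** Diagonalization: the vector of index [k] is taken in all the spans of [Xs 0], ..., [Xs k], so
    the tail from [n] on lies in the span of [Xs n]. *)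
Lemma pseudo_intersection (Xs : nat -> nat -> vec F) :
  (forall n, block_seq (Xs n)) -> (forall n, almost_le (Xs n.+1) (Xs n)) ->
  exists Y, block_seq Y /\ forall n, almost_le Y (Xs n).
Proof.
move=> bX dX.
have uni k : exists N, forall v, in_span (Xs k) v -> above N v ->
    forall j, (j <= k)%N -> in_span (Xs j) v.
  elim: k => [|k [N HN]]; first by exists 0%N => v Xv _ j; rewrite leqn0 => /eqP->.
  have [M HM] := dX k; exists (maxn N M) => v Xv av j; rewrite leq_eqVlt.
  case/orP=> [/eqP-> //|]; rewrite ltnS; apply: HN.
    by apply: HM Xv (above_le _ av); rewrite leq_maxr.
  by apply: above_le av; rewrite leq_maxl.
have pick k m : exists y, [/\ nonzero y, finsupp y, above m y &
    forall j, (j <= k)%N -> in_span (Xs j) y].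
  have [N HN] := uni k; have [y [Xy ny fy ay]] := in_span_above (maxn N m) (bX k).
  exists y; split=> //; first by apply: above_le ay; rewrite leq_maxr.
  by apply: HN => //; apply: above_le ay; rewrite leq_maxl.
pose P (s : nat * vec F) := [/\ nonzero s.2, finsupp s.2 &
  forall j, (j <= s.1)%N -> in_span (Xs j) s.2].
have [y0 [n0 f0 _ i0]] := pick 0%N 0%N.
have [|[k y] /= [ny fy iy]|st [st0 Hst]] := @dependent_choice _ P
  (fun s s' => s'.1 = s.1.+1 /\ supp_lt s.2 s'.2) (0%N, y0); first by split.
  have [N HN] := finsupp_above fy; have [y' [ny' fy' ay' iy']] := pick k.+1 N.
  by exists (k.+1, y'); split; [split|split=> //; apply: HN].
have st1 k : (st k).1 = k.
  by elim: k => [|k IH]; [rewrite st0|have [_ [-> _]] := Hst k; rewrite IH].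
have bY : block_seq (fun k => (st k).2).
  by move=> k; have [[nk fk _] [_ lk]] := Hst k.
exists (fun k => (st k).2); split=> // n.
have [N HN] := in_span_tail n bY; exists N => v Yv av.
apply: in_span_trans (HN _ Yv av) => k.
have [[_ _ H] _] := Hst (n + k)%N; apply: H.
by rewrite st1 leq_addr.
Qed.

(** The default [zero_vec] has empty support, so every vector fits the empty sequence. *)
Definition fits x y := supp_lt (last zero_vec x) y.

Definition vec_of (l : seq F) : vec F := fun i => nth 0 l i.

Definition code_vecs (k : nat) : seq (vec F) := map vec_of (odflt [::] (unpickle k)).

(* Holds for all finite sequences of finitely supported vectors; being countable,
   they can index the requirements of a fusion. *)
Definition coded x := exists k, code_vecs k = x.

Lemma coded_nil : coded [::].
Proof. by exists (pickle ([::] : seq (seq F))); rewrite /code_vecs pickleK. Qed.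

Lemma vec_ofE v : finsupp v -> exists l, v = vec_of l.
Proof.
move=> [N HN]; exists (mkseq v N); apply: functional_extensionality => i.
rewrite /vec_of; have [lt|le] := ltnP i N; first by rewrite nth_mkseq.
by rewrite nth_default ?HN // size_mkseq.
Qed.

Lemma coded_rcons x y : coded x -> finsupp y -> coded (rcons x y).
Proof.
move=> [k <-] /vec_ofE[l ->].
exists (pickle (rcons (odflt [::] (unpickle k) : seq (seq F)) l)).
by rewrite /code_vecs pickleK /= map_rcons.
Qed.

Lemma coded_cons x y : coded x -> finsupp y -> coded (y :: x).
Proof.
move=> [k <-] /vec_ofE[l ->].
by exists (pickle (l :: (odflt [::] (unpickle k) : seq (seq F)))); rewrite /code_vecs pickleK.
Qed.

Lemma coded_mkseq Z k : block_seq Z -> coded (mkseq Z k).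
Proof.
move=> bZ; elim: k => [|k IH]; first exact: coded_nil.
by rewrite mkseqS; apply: coded_rcons => //; have [] := bZ k.
Qed.

Lemma fits_mkseq Z k : block_seq Z -> fits (mkseq Z k) (Z k).
Proof.
move=> bZ; case: k => [|k]; first by move=> i j; rewrite /in_supp eqxx.
by rewrite /fits mkseqS last_rcons; have [_ []] := bZ k.
Qed.

End BlockSequences.

(** * Fusion *)

Section Fusion.
Variable F : countFieldType.
Implicit Types (X Y Z : nat -> vec F) (p q r : (nat -> bool) -> Prop) (t : nat -> bool).

(** The order on conditions. Sequences are compared by almost inclusion, so that descending chains
    have lower bounds by [pseudo_intersection]. *)
Definition refines q Y p X :=
  [/\ perfect q, subset_of q p, block_seq Y & almost_le Y X].

Lemma refines_refl p X : perfect p -> block_seq X -> refines p X p X.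
Proof. by move=> pp bX; split=> //; apply: almost_le_refl. Qed.

Lemma refines_trans q Y r Z p X : refines r Z q Y -> refines q Y p X -> refines r Z p X.
Proof.
move=> [rp rq bZ ZY] [_ qp _ YX]; split=> //; first by move=> t /rq /qp.
exact: almost_le_trans ZY YX.
Qed.

Lemma refines_cyl q Y p X t m : q t -> refines q Y p X -> refines (cyl q t m) Y p X.
Proof.
move=> qt [pq qp bY YX]; split=> //; first exact: perfect_cyl.
by move=> u [/qp].
Qed.

Definition dense_below (D : ((nat -> bool) -> Prop) -> (nat -> vec F) -> Prop) p X :=
  forall q Y, refines q Y p X -> exists q' Y', refines q' Y' q Y /\ D q' Y'.

(** The nodes of level [M] are treated in turn: each shrinks the current sequence and receives its
    own perfect set, and monotonicity of [D] in the sequence preserves what was obtained before.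
    [r'] is the union of these perfect sets. *)
Lemma amalgamation (D : ((nat -> bool) -> Prop) -> (nat -> vec F) -> Prop) r X M :
  (forall q Y Y', almost_le Y' Y -> D q Y -> D q Y') ->
  perfect r -> block_seq X -> dense_below D r X ->
  exists r' X', [/\ refines r' X' r X, forall t, r t -> exists t', r' t' /\ agree M t t' &
                    forall t, r' t -> D (cyl r' t M) X'].
Proof.
move=> Dmono rp bX Dd.
pose T := {Y : nat -> vec F | block_seq Y /\ almost_le Y X}.
pose le (a b : T) := almost_le (proj1_sig b) (proj1_sig a).
pose P t (a : T) := (exists u, cyl r t M u) ->
  exists R, [/\ perfect R, subset_of R (cyl r t M) & D R (proj1_sig a)].
have [|||||[X' [bX' X'X]] [_ HX']] :=
  @all_nodes T le M P _ _ _ _ _ (exist _ X (conj bX (almost_le_refl X))).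
- by move=> a; apply: almost_le_refl.
- by move=> b a c ab bc; apply: almost_le_trans bc ab.
- by move=> t t' a e; rewrite /P (cyl_eq r e).
- move=> t a b ab Pa ex; have [R [pR sR DR]] := Pa ex; exists R; split=> //.
  exact: Dmono ab DR.
- move=> t [Y [bY YX]]; have [[u [ru e]]|nex] := classic (exists u, cyl r t M u); last first.
    by exists (exist _ Y (conj bY YX)); split=> //; apply: almost_le_refl.
  have [|R [Y' [[pR sR bY' Y'Y] DR]]] := Dd (cyl r t M) Y.
    by rewrite (cyl_eq r e); apply: refines_cyl => //; split.
  exists (exist _ Y' (conj bY' (almost_le_trans Y'Y YX))); split=> // _.
  by exists R.
have [Rf HR] : exists Rf : (nat -> bool) -> (nat -> bool) -> Prop, forall t,
    subset_of (Rf t) (cyl r t M) /\ ((exists u, cyl r t M u) -> perfect (Rf t) /\ D (Rf t) X').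
  apply: (choice_fun (R := fun t R => subset_of R (cyl r t M) /\
     ((exists u, cyl r t M u) -> perfect R /\ D R X'))) => t.
  have [ex|nex] := classic (exists u, cyl r t M u); last by exists (fun=> False).
  by have [R [pR sR DR]] := HX' t ex; exists R.
(* Truncation gives each node a canonical representative, so that all its branches refer to the same
   chosen perfect set. *)
pose node t i := if i < M then t i else false.
have node_eq t t' : agree M t t' -> node t = node t'.
  by move=> e; apply: functional_extensionality => i; rewrite /node; case: ifP => // /e.
have node_agree t : agree M (node t) t by move=> i lt; rewrite /node lt.
pose r' t := Rf (node t) t.
have r'r : subset_of r' r by move=> t r't; have [/(_ t r't)[]] := HR (node t).
have keep t : r t -> exists t', r' t' /\ agree M t t'.
  move=> rt; have [sR Hn] := HR (node t); have [|[[t' Rt'] _ _] _] := Hn.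
    by exists t; split.
  have [_ e] := sR t' Rt'; exists t'; rewrite /r'.
  have e' : agree M t t' by apply: agree_trans (agree_sym (node_agree t)) e.
  by rewrite -(node_eq _ _ e').
have r'_node t : r' t -> perfect (Rf (node t)) /\ D (Rf (node t)) X'.
  by move=> r't; have [sR Hn] := HR (node t); apply: Hn; exists t; apply: sR.
exists r', X'; split=> //.
- split=> //; split.
  + by have [[t rt] _ _] := rp; have [t' [r't' _]] := keep t rt; exists t'.
  + move=> t H; have [u [r'u e]] := H M; have [[_ cl _] _] := r'_node u r'u.
    rewrite /r' (node_eq _ _ e); apply: cl => n; have [v [r'v e']] := H (maxn n M).
    exists v; split; last by apply: agree_le e'; rewrite leq_maxl.
    rewrite -(node_eq _ _ e) (node_eq _ v) //.
    by apply: agree_le e'; rewrite leq_maxr.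
  + move=> t r't n; have [[_ _ sp] _] := r'_node t r't.
    have [u [Ru e d]] := sp t r't (maxn n M); exists u; split=> //.
      rewrite /r' -(node_eq t u) //; apply: agree_le e; exact: leq_maxr.
    by apply: agree_le e; apply: leq_maxl.
- move=> t r't; have [_ DR] := r'_node t r't.
  suff -> : cyl r' t M = Rf (node t) by [].
  apply: set_eq => u; split=> [[r'u e]|Ru]; first by rewrite (node_eq _ _ e).
  have [sR _] := HR (node t); have [_ e] := sR _ Ru.
  have e' : agree M t u by apply: agree_trans (agree_sym (node_agree t)) e.
  by split=> //; rewrite /r' -(node_eq _ _ e').
Qed.

(** Stage [k] amalgamates for [D k] at the current level, then raises the level until every node has
    split. Each requirement is therefore met node by node, at the level where it was treated. *)
Lemma fusion (D : nat -> ((nat -> bool) -> Prop) -> (nat -> vec F) -> Prop) p X :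
  (forall k q q' Y Y', subset_of q' q -> almost_le Y' Y -> D k q Y -> D k q' Y') ->
  perfect p -> block_seq X -> (forall k, dense_below (D k) p X) ->
  exists q Y, refines q Y p X /\ forall k, exists m, forall t, q t -> D k (cyl q t m) Y.
Proof.
move=> Dmono pp bX Dd.
pose S := (nat * ((nat -> bool) -> Prop) * (nat -> vec F) * nat)%type.
pose P (s : S) := let: (k, r, Y, M) := s in refines r Y p X.
pose R (s s' : S) := let: (k, r, Y, M) := s in let: (k', r', Y', M') := s' in
  [/\ k' = k.+1, subset_of r' r, almost_le Y' Y, M < M' &
  [/\ forall t, r t -> exists t', r' t' /\ agree M t t',
      forall t, r' t -> exists t', [/\ r' t', agree M t t' & ~ agree M' t t'] &
      forall t, r' t -> D k (cyl r' t M) Y']].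
have [||st [st0 Hst]] := @dependent_choice S P R (0, p, X, 0).
- exact: refines_refl.
- move=> [[[k r] Y] M] /= rY; have [rp rsub bY YX] := rY.
  have [||||r' [Y' [rY' keep HD]]] := @amalgamation (D k) r Y M.
  + by move=> q Z Z' le; apply: Dmono.
  + by [].
  + by [].
  + by move=> q Z qZ; apply: Dd (refines_trans qZ rY).
  have [rp' rsub' bY' YY'] := rY'.
  have [M' [lt sp]] := splitting_level M rp'.
  by exists (k.+1, r', Y', M'); split=> //; apply: refines_trans rY' rY.
pose sr n := (st n).1.1.2; pose sY n := (st n).1.2; pose sM n := (st n).2.
have stE n : st n = (n, sr n, sY n, sM n).
  rewrite /sr /sY /sM; suff : (st n).1.1.1 = n by case: (st n) => [[[k r] Y] M] /= ->.
  elim: n => [|n IH]; first by rewrite st0.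
  have [_] := Hst n; move: IH.
  by case: (st n) (st n.+1) => [[[k r] Y] M] [[[k' r'] Y'] M'] /= -> [->].
have HP n : refines (sr n) (sY n) p X by have [] := Hst n; rewrite stE.
have HR n : [/\ subset_of (sr n.+1) (sr n), almost_le (sY n.+1) (sY n), sM n < sM n.+1 &
  [/\ forall t, sr n t -> exists t', sr n.+1 t' /\ agree (sM n) t t',
      forall t, sr n.+1 t -> exists t', [/\ sr n.+1 t', agree (sM n) t t' & ~ agree (sM n.+1) t t'] &
      forall t, sr n.+1 t -> D n (cyl (sr n.+1) t (sM n)) (sY n.+1)]].
  by have [_] := Hst n; rewrite !stE => -[].
have [||Y [bY HY]] := pseudo_intersection (Xs := sY).
- by move=> n; have [] := HP n.
- by move=> n; have [] := HR n.
exists (fun t => forall n, sr n t), Y; split.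
  split=> //.
  + by apply: (perfect_fusion (M := sM)) => n; case: (HR n) => // _ _ _ []; case: (HP n).
  + by move=> t /(_ 0); have [_ H _ _] := HP 0; apply: H.
  + by apply: almost_le_trans (HY 0) _; have [] := HP 0.
move=> k; exists (sM k) => t qt.
have [_ _ _ [_ _ H]] := HR k; apply: Dmono (HY k.+1) (H t (qt _)).
by apply: cyl_mono => // u.
Qed.

End Fusion.

(** * Uniform avoidance of sets of vectors *)

Section ClosedWitness.
Variable F : countFieldType.
Import GRing.Theory.
Implicit Types (X Y Z V : nat -> vec F) (p q r : (nat -> bool) -> Prop) (t : nat -> bool).
Implicit Types (y v w a : vec F) (ys : seq (vec F)).

Definition open_on (A : Type) q (G : (nat -> bool) -> A -> Prop) :=
  forall t (x : A), q t -> G t x -> exists m, forall t', cyl q t m t' -> G t' x.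

Fixpoint list_span ys a : Prop :=
  if ys is y :: ys' then exists c a', list_span ys' a' /\ a = lin c y a'
  else a = zero_vec F.

Lemma list_span_mkseq Y v : in_span Y v ->
  exists n, forall N, n <= N -> list_span (rev (mkseq Y N)) v.
Proof.
move=> /in_span_pad[n [c H]]; exists n => N /H {}H.
have -> : v = (fun i => \sum_(k < N) c k * Y k i)%R by apply: functional_extensionality.
elim: N {H} => [|N IH] /=.
  by apply: functional_extensionality => i; rewrite big_ord0.
rewrite mkseqS rev_rcons /=; exists (c N), (fun i => \sum_(k < N) c k * Y k i)%R.
by split=> //; apply: functional_extensionality => i; rewrite big_ord_recr /= /lin addrC.
Qed.

Lemma above_lin n c v w : above n v -> above n w -> above n (lin c v w).
Proof.
move=> av aw i; rewrite /in_supp /lin; have [vi|/av //] := eqVneq (v i) 0%R.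
by rewrite vi mulr0 add0r => /aw.
Qed.

Variable G : (nat -> bool) -> vec F -> Prop.

Definition avoids t ys V :=
  exists n, forall w a, in_span V w -> above n w -> list_span ys a -> ~ G t (lin 1%R a w).

(** Invariant kept while the vectors [ys] of the future sequence are chosen. Asking it below every
    refinement provides avoiding points in every node. *)
Definition avoidable q ys Y :=
  forall q' Y', refines q' Y' q Y ->
    exists t V, [/\ q' t, block_seq V, almost_le V Y' & avoids t ys V].

Lemma avoids_le t ys V V' : almost_le V' V -> avoids t ys V -> avoids t ys V'.
Proof.
move=> [n H] [m K]; exists (maxn n m) => w a Vw aw; apply: K.
  by apply: H Vw _; apply: above_le aw; rewrite leq_maxl.
by apply: above_le aw; rewrite leq_maxr.
Qed.

Lemma avoidable_le q q' ys Y Y' :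
  subset_of q' q -> almost_le Y' Y -> avoidable q ys Y -> avoidable q' ys Y'.
Proof.
move=> sq le H r Z [rp sr bZ ZY]; apply: H; split=> //; first by move=> t /sr /sq.
exact: almost_le_trans ZY le.
Qed.

(** The multiple of [y] can be moved from the list to the tail: [lin c y w] is again a vector of the
    span of [V] above [n]. *)
Lemma avoids_cons t ys V n y :
  (forall w a, in_span V w -> above n w -> list_span ys a -> ~ G t (lin 1%R a w)) ->
  in_span V y -> above n y -> avoids t (y :: ys) V.
Proof.
move=> H Vy ay; exists n => w b Vw aw /= [c [a [la ->]]].
have -> : lin 1%R (lin c y a) w = lin 1%R a (lin c y w).
  by apply: functional_extensionality => i; rewrite /lin !mul1r addrCA addrA.
by apply: H => //; [apply: in_span_lin|apply: above_lin].
Qed.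

Lemma avoidable_step q Y r ys M :
  block_seq Y -> (forall zs, coded zs -> exists m, forall t, q t ->
     avoidable (cyl q t m) zs Y \/
     forall t' V, cyl q t m t' -> block_seq V -> almost_le V Y -> ~ avoids t' zs V) ->
  perfect r -> subset_of r q -> coded ys -> finsupp (head (zero_vec F) ys) -> avoidable r ys Y ->
  exists r' y, [/\ perfect r', subset_of r' r, avoidable r' (y :: ys) Y,
    forall t, r t -> exists t', r' t' /\ agree M t t' &
    [/\ in_span Y y, nonzero y, finsupp y & supp_lt (head (zero_vec F) ys) y]].
Proof.
move=> bY dec rp rq cys fys ok.
have [||r1 [X [[r1p r1r bX XY] keep Dr1]]] :=
  @amalgamation F (fun q' V => exists t, q' t /\ avoids t ys V) r Y M _ rp bY _.
- by move=> q' V V' le [t [q't av]]; exists t; split=> //; apply: avoids_le av.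
- move=> q' Y' rY; have [t [V [q't bV VY av]]] := ok q' Y' rY.
  exists q', V; split; last by exists t.
  by have [q'p _ _ _] := rY; split.
(* [X] avoids [G] at one point [t'] of each node, with a common bound [N]; hence
   every [y] in its span above [N] can be added to [ys] at each [t']. *)
have [|t /Dr1[t' [r1t' [N HN]]]|N HN] := @node_bound M r1 (fun c N => exists t', c t' /\
    forall w a, in_span X w -> above N w -> list_span ys a -> ~ G t' (lin 1%R a w)).
- move=> c N N' le [t' [ct' H]]; exists t'; split=> // w a Xw aw.
  by apply: H => //; apply: above_le aw.
- by exists N, t'.
have [N1 HN1] := finsupp_above fys; have [N2 HN2] := XY.
have [y [Xy ny fy ay]] := in_span_above (maxn N (maxn N1 N2)) bX.
move: ay => /[dup] /(above_le (leq_maxl _ _)) ayN /(above_le (leq_maxr _ _)).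
move=> /[dup] /(above_le (leq_maxl _ _)) ayN1 /(above_le (leq_maxr _ _)) ayN2.
(* Near each point, [y :: ys] is either avoidable or avoided by no [V] at all. The sequence [X]
   refutes the second case at each [t'], so keeping only the points of the first kind loses no node
   of level [M]. *)
have [m Hm] := dec _ (coded_cons cys fy).
pose K t := avoidable (cyl q t m) (y :: ys) Y.
have keep' t : r t -> exists t', (r t' /\ K t') /\ agree M t t'.
  move=> /keep[u [r1u tu]]; have [t' [[r1t' ut'] Ht']] := HN u r1u.
  exists t'; split; last exact: agree_trans tu ut'.
  split; first exact: r1r.
  have [//|Hno] := Hm t' (rq _ (r1r _ r1t')).
  by case: (Hno t' X) => //; [split=> //; apply/rq/r1r|apply: avoids_cons ayN].
exists (fun t => r t /\ K t), y; split=> //.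
- apply: (@perfect_clopen _ _ m) => //; first by move=> t t' _ _ e; rewrite /K (cyl_eq q e).
  by have [[t rt] _ _] := rp; have [t' [H _]] := keep' t rt; exists t'.
- by move=> t [].
- move=> q' Y' [q'p sq' bY' Y'Y]; have [[t q't] _ _] := q'p.
  have [rt Kt] := sq' t q't.
  have [|t' [V [[q't' _] bV VY av]]] := Kt (cyl q' t m) Y'.
    split=> //; first exact: perfect_cyl.
    by apply: cyl_mono => // u /sq'[/rq].
  by exists t', V.
- by split=> //; [apply: HN2|apply: HN1].
Qed.

Lemma uniform_avoidance q X : perfect q -> block_seq X -> open_on q G ->
  exists q' Y, refines q' Y q X /\
    ((forall t y, q' t -> in_span Y y -> ~ G t y) \/
     (forall t V, q' t -> block_seq V -> almost_le V Y -> exists y, in_span V y /\ G t y)).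
Proof.
move=> qp bX Gop.
have [ok|nok] := classic (avoidable q [::] X); last first.
  have [q' [Y [rY H]]] : exists q' Y, refines q' Y q X /\
      forall t V, q' t -> block_seq V -> almost_le V Y -> ~ avoids t [::] V.
    apply: NNPP => nex; apply: nok => q' Y rY; apply: NNPP => nex'; apply: nex.
    by exists q', Y; split=> // t V q't bV VY av; apply: nex'; exists t, V.
  (* The empty list spans only zero, so a [V] that does not avoid it has a vector of its own span in
     [G t]. *)
  exists q', Y; split=> //; right=> t V q't bV VY; apply: NNPP => nex.
  apply: (H t V) => //; exists 0 => w a Vw _ /= -> Gw; apply: nex; exists w; split=> //.
  suff -> : w = lin 1%R (zero_vec F) w by [].
  by apply: functional_extensionality => i; rewrite /lin /zero_vec mulr0 add0r.
have [|k q1 Y1 q1X|q1 [Y [q1X dec]]] := @fusion F (fun k q Y => avoidable q (code_vecs F k) Y \/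
  forall t V, q t -> block_seq V -> almost_le V Y -> ~ avoids t (code_vecs F k) V) q X _ qp bX _.
- move=> k r r' Z Z' rr' le [ok'|no]; first by left; apply: avoidable_le ok'.
  by right=> t V /rr' r't bV VZ; apply: no => //; apply: almost_le_trans VZ le.
- have [ok'|nok] := classic (avoidable q1 (code_vecs F k) Y1).
    by exists q1, Y1; split; [apply: refines_refl; case: q1X|left].
  apply: NNPP => nex; apply: nok => q' Y' rY'; apply: NNPP => nex'; apply: nex.
  by exists q', Y'; split=> //; right=> t V q't bV VY av; apply: nex'; exists t, V.
have {}dec zs : coded zs -> exists m, forall t, q1 t ->
     avoidable (cyl q1 t m) zs Y \/
     forall t' V, cyl q1 t m t' -> block_seq V -> almost_le V Y -> ~ avoids t' zs V.
  by move=> [k <-].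
have [q1p q1q bY YX] := q1X.
pose S := (((nat -> bool) -> Prop) * seq (vec F) * nat)%type.
pose P (s : S) := let: (r, ys, M) := s in
  [/\ perfect r, subset_of r q1, coded ys, finsupp (head (zero_vec F) ys) & avoidable r ys Y].
pose R (s s' : S) := let: (r, ys, M) := s in let: (r', ys', M') := s' in
  exists y, [/\ ys' = y :: ys, subset_of r' r, M < M',
    [/\ in_span Y y, nonzero y, finsupp y & supp_lt (head (zero_vec F) ys) y] &
    (forall t, r t -> exists t', r' t' /\ agree M t t') /\
    (forall t, r' t -> exists t', [/\ r' t', agree M t t' & ~ agree M' t t'])].
have [||st [st0 Hst]] := @dependent_choice S P R (q1, [::], 0).
- split=> //; [exact: coded_nil|by exists 0|].
  exact: avoidable_le ok.
- move=> [[r ys] M] /= [rp rq cys fys okr].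
  have [r' [y [r'p r'r okr' keep Hy]]] := avoidable_step M bY dec rp rq cys fys okr.
  have [_ _ fy _] := Hy; have [M' [lt sp]] := splitting_level M r'p.
  exists (r', y :: ys, M'); split; last by exists y.
  by split=> //; [move=> t /r'r /rq|apply: coded_cons].
pose sr n := (st n).1.1; pose sys n := (st n).1.2; pose sM n := (st n).2.
have stE n : st n = (sr n, sys n, sM n) by rewrite /sr /sys /sM; case: (st n) => [[]].
pose Z n := head (zero_vec F) (sys n.+1).
have HP n : [/\ perfect (sr n), subset_of (sr n) q1, coded (sys n),
   finsupp (head (zero_vec F) (sys n)) & avoidable (sr n) (sys n) Y].
  by have [] := Hst n; rewrite stE.
have HR n : [/\ sys n.+1 = Z n :: sys n, subset_of (sr n.+1) (sr n), sM n < sM n.+1,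
    [/\ in_span Y (Z n), nonzero (Z n), finsupp (Z n) & supp_lt (head (zero_vec F) (sys n)) (Z n)] &
    (forall t, sr n t -> exists t', sr n.+1 t' /\ agree (sM n) t t') /\
    (forall t, sr n.+1 t -> exists t', [/\ sr n.+1 t', agree (sM n) t t' & ~ agree (sM n.+1) t t'])].
  by have [_] := Hst n; rewrite !stE /Z => -[y [-> *]].
have bZ : block_seq Z.
  move=> k; have [_ _ _ [_ nk fk _] _] := HR k; split=> //; split=> //.
  by have [_ _ _ [_ _ _ lk] _] := HR k.+1.
have sysE n : sys n = rev (mkseq Z n).
  elim: n => [|n IH]; first by rewrite /sys st0.
  by have [-> _ _ _ _] := HR n; rewrite mkseqS rev_rcons IH.
have ZY k : in_span Y (Z k) by have [_ _ _ []] := HR k.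
exists (fun t => forall n, sr n t), Z; split.
  apply: refines_trans q1X; split=> //.
  + by apply: (perfect_fusion (M := sM)) => n; case: (HP n) => // _ _ _ _ _;
      case: (HR n) => // _ _ _ _ [].
  + by move=> t /(_ 0); have [_ H _ _ _] := HP 0; apply: H.
  + exact: almost_le_preceq.
(* [G] holds at [y] on a neighbourhood of [t], and [y] is in the span of the first [n] vectors.
   Avoidability at stage [n] gives a point of this neighbourhood at which that span, taken with tail
   vector zero, misses [G]. *)
left=> t y qt Zy Gy.
have [_ r0q1 _ _ _] := HP 0; have [m Hm] := Gop t y (q1q _ (r0q1 _ (qt 0))) Gy.
have [n Hn] := list_span_mkseq Zy.
have [rp rq _ _ okr] := HP n.
have [|t' [V [[rt' e] bV VY [N HN]]]] := okr (cyl (sr n) t m) Y.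
  by split=> //; [apply: perfect_cyl|apply: cyl_sub|apply: almost_le_refl].
apply: (HN (zero_vec F) y).
- exact: in_span_zero.
- by move=> i; rewrite /in_supp eqxx.
- by rewrite sysE; apply: Hn.
suff -> : lin 1%R y (zero_vec F) = y by apply: Hm; split=> //; apply/q1q/rq.
by apply: functional_extensionality => i; rewrite /lin /zero_vec mul1r addr0.
Qed.

End ClosedWitness.

(** * Games *)

Section Games.
Variable F : countFieldType.
Implicit Types (X Y Z V : nat -> vec F) (p q r : (nat -> bool) -> Prop) (t : nat -> bool).
Implicit Types (y : vec F) (x z : seq (vec F)).

Definition plays Y (sigma : seq (vec F) -> nat) x Z :=
  [/\ block_seq Z, mkseq Z (size x) = x &
      forall k, size x <= k -> in_span Y (Z k) /\ above (sigma (mkseq Z k)) (Z k)].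

(* Strategies of II for reaching some position in a Gowers game: the move [V] is
   answered by [f V], and [g V] is the strategy for the rest of the game. *)
Inductive strat :=
| Done
| Move of ((nat -> vec F) -> vec F) & ((nat -> vec F) -> strat).

(** The moves [V] range over all sequences almost below [Y], so that winning passes to every
    sequence almost below [Y]. *)
Fixpoint wins (U : seq (vec F) -> Prop) Y (T : strat) x : Prop :=
  match T with
  | Done => U x
  | Move f g => forall V, block_seq V -> almost_le V Y ->
      [/\ in_span V (f V), nonzero (f V), fits x (f V) & wins U Y (g V) (rcons x (f V))]
  end.

Definition reach U Y x := exists T, wins U Y T x.

Lemma reach_now (U : seq (vec F) -> Prop) Y x : U x -> reach U Y x.
Proof. by exists Done. Qed.

Lemma reach_later U Y x :
  (forall V, block_seq V -> almost_le V Y ->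
     exists y, [/\ in_span V y, nonzero y, fits x y & reach U Y (rcons x y)]) ->
  reach U Y x.
Proof.
move=> H.
have [fg Hfg] : exists fg : (nat -> vec F) -> vec F * strat, forall V,
    block_seq V -> almost_le V Y -> [/\ in_span V (fg V).1, nonzero (fg V).1,
      fits x (fg V).1 & wins U Y (fg V).2 (rcons x (fg V).1)].
  apply: (choice_fun (R := fun V (yT : vec F * strat) => block_seq V -> almost_le V Y ->
    [/\ in_span V yT.1, nonzero yT.1, fits x yT.1 & wins U Y yT.2 (rcons x yT.1)])) => V.
  have [[bV VY]|no] := classic (block_seq V /\ almost_le V Y).
    by have [y [Vy ny fy [T wT]]] := H V bV VY; exists (y, T).
  by exists (zero_vec F, Done) => bV VY; case: no.
by exists (Move (fun V => (fg V).1) (fun V => (fg V).2)) => V /= bV VY; apply: Hfg.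
Qed.

Lemma reach_le U Y Y' x : almost_le Y' Y -> reach U Y x -> reach U Y' x.
Proof.
move=> le [T wT]; exists T; elim: T x wT => [//|f g IH] x /= H V bV VY'.
by have [Vf nf ff wg] := H V bV (almost_le_trans VY' le); split=> //; apply: IH.
Qed.

(** A position is good when II can reach [U] from it for all nearby [t]. If [x] is good nowhere,
    [uniform_avoidance] applied to the good continuations gives I bounds beyond which no move of II
    leads from a position that is not good to a good one. *)
Lemma open_game (U : (nat -> bool) -> seq (vec F) -> Prop) q X x :
  perfect q -> block_seq X -> coded x -> open_on q U ->
  exists q' Y, refines q' Y q X /\
    ((forall t, q' t -> reach (U t) Y x) \/
     exists sigma, forall t Z, q' t -> plays Y sigma x Z ->
       forall k, size x <= k -> ~ U t (mkseq Z k)).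
Proof.
move=> qp bX cx Uop.
have [|k q1 Y1 q1X|q1 [Y1 [q1X dec]]] := @fusion F (fun k q Y =>
    (forall t, q t -> reach (U t) Y (code_vecs F k)) \/
    (forall q' Y', refines q' Y' q Y -> exists t, q' t /\ ~ reach (U t) Y' (code_vecs F k))) q X _ qp bX _.
- move=> k r r' Z Z' rr' le [H|H]; [left=> t /rr' /H|right=> q' Y' [q'p q'r bY' Y'Z]].
    exact: reach_le.
  by apply: H; split=> //; [move=> t /q'r /rr'|apply: almost_le_trans Y'Z le].
- have [[q' [Y' [rY' H]]]|nex] := classic (exists q' Y', refines q' Y' q1 Y1 /\
      forall t, q' t -> reach (U t) Y' (code_vecs F k)).
    by exists q', Y'; split=> //; left.
  exists q1, Y1; split; first by apply: refines_refl; case: q1X.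
  right=> q' Y' rY'; apply: NNPP => nex'; apply: nex; exists q', Y'; split=> // t q't.
  by apply: NNPP => nr; apply: nex'; exists t.
have {}dec z : coded z -> exists m, forall t, q1 t ->
    (forall t', cyl q1 t m t' -> reach (U t') Y1 z) \/
    (forall q' Y', refines q' Y' (cyl q1 t m) Y1 -> exists t, q' t /\ ~ reach (U t) Y' z).
  by move=> [k <-].
have [q1p q1q bY1 Y1X] := q1X.
(* Asking for a whole neighbourhood makes goodness open in [t], as [uniform_avoidance] requires. *)
pose good t z := exists m, forall t', cyl q1 t m t' -> reach (U t') Y1 z.
have good_reach t z : q1 t -> good t z -> reach (U t) Y1 z by move=> q1t [m]; apply.
have good_open t z : good t z -> exists m, forall t', agree m t t' -> good t' z.
  move=> [m Hm]; exists m => t' e; exists m => u /(cyl_recenter (leqnn m) e); exact: Hm.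
have [[t [q1t [m Hm]]]|nogood] := classic (exists t, q1 t /\ good t x).
  by exists (cyl q1 t m), Y1; split; [apply: refines_cyl|left].
have [|k q' Y' q'Y|q2 [Y2 [q2Y worse]]] := @fusion F (fun k q Y =>
    (forall t, q t -> good t (code_vecs F k)) \/
    (exists n, forall t y, q t -> in_span Y y -> above n y -> nonzero y -> fits (code_vecs F k) y ->
       ~ good t (rcons (code_vecs F k) y))) q1 Y1 _ q1p bY1 _.
- move=> k r r' Z Z' rr' [n le] [H|[n' H]]; [by left=> t /rr' /H|right; exists (maxn n n')].
  move=> t y /rr' rt Z'y ay; apply: H => //; last by apply: above_le ay; rewrite leq_maxr.
  by apply: le => //; apply: above_le ay; rewrite leq_maxl.
- have [q'p q'q1 bY' Y'Y] := q'Y; have [[t q't] _ _] := q'p.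
  have [m Hm] := dec _ (ex_intro _ k (erefl _)); set z := code_vecs F k in Hm *.
  have [gt|ngt] := classic (good t z).
    have [m' Hm'] := good_open _ _ gt; exists (cyl q' t m'), Y'; split; last by left=> u [_ /Hm'].
    by apply: refines_cyl => //; apply: refines_refl.
  have {Hm}[H|H] := Hm t (q'q1 _ q't); first by case: ngt; exists m.
  have c'p : perfect (cyl q' t m) by apply: perfect_cyl.
  have [|q'' [Y'' [rY'' alt]]] := @uniform_avoidance F
    (fun t y => [/\ nonzero y, fits z y & good t (rcons z y)]) (cyl q' t m) Y' c'p bY'.
    move=> u y _ [ny fy /good_open[m' Hm']]; exists m' => t' [_ /Hm' gt']; by split.
  have rq'' : refines q'' Y'' q' Y' by apply:
    refines_trans rY'' (refines_cyl m q't (refines_refl _ _)).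
  exists q'', Y''; split=> //; case: alt => [no|yes].
    by right; exists 0 => u y q''u Yy _ ny fy gu; apply: (no u y).
  (* [H] gives a point where II cannot reach [U] from [z]; but at this point every [V] contains a
     good continuation of [z], which II can play. *)
  have [|u [q''u]] := H q'' Y''.
    have [q''p q''c bY'' Y''Y'] := rY''; split=> //; last exact: almost_le_trans Y''Y' Y'Y.
    by move=> u /q''c; apply: cyl_mono.
  case; apply: reach_later => V bV VY''; have [y [Vy [ny fy gy]]] := yes u V q''u bV VY''.
  exists y; split=> //; have [_ _ _ Y''Y'] := rq''.
  apply: reach_le (almost_le_trans Y''Y' Y'Y) (good_reach _ _ _ gy).
  by have [_ s _ _] := rq''; apply/q'q1/s.
have [q2p q2q1 bY2 Y2Y] := q2Y.
have [sigma Hs] : exists sigma : seq (vec F) -> nat, forall z, coded z ->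
    forall t y, q2 t -> ~ good t z ->
    in_span Y2 y -> above (sigma z) y -> nonzero y -> fits z y -> ~ good t (rcons z y).
  apply: (choice_fun (R := fun z n => coded z -> forall t y, q2 t -> ~ good t z ->
    in_span Y2 y -> above n y -> nonzero y -> fits z y -> ~ good t (rcons z y))) => z.
  have [[k <-]|ncz] := classic (coded z); last by exists 0.
  have [m Hm] := worse k.
  (* The bound may depend on the node of [t]; [node_bound] makes it uniform, so that I has one move
     for all [t]. *)
  have [||n Hn] := @node_bound m q2 (fun c n => forall t y, c t -> ~ good t (code_vecs F k) ->
     in_span Y2 y -> above n y -> nonzero y -> fits (code_vecs F k) y ->
     ~ good t (rcons (code_vecs F k) y)).
  + move=> c a b le H t y ct ng Yy ay; apply: H => //; exact: above_le ay.
  + move=> t /Hm[H|[n H]]; last by exists n => u y cu _; apply: H.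
    by exists 0 => u y /H.
  by exists n => _ t y q2t; apply: (Hn t q2t); apply: cyl_self.
exists q2, Y2; split; first exact: refines_trans q2Y q1X.
right; exists sigma => t Z q2t [bZ Zx HZ].
have ng k : size x <= k -> ~ good t (mkseq Z k).
  have ngx : ~ good t x by move=> g; apply: nogood; exists t; split=> //; apply: q2q1.
  elim: k => [|k IH]; first by rewrite leqn0 => /eqP<-; rewrite Zx.
  rewrite leq_eqVlt => /orP[/eqP<-|]; first by rewrite Zx.
  rewrite ltnS => le; rewrite mkseqS; have [ZY2 aZ] := HZ k le.
  apply: Hs => //; first exact: coded_mkseq.
  - exact: IH.
  - by have [_ []] := bZ k.
  - exact: fits_mkseq.
(* As [U] is open, a position in [U] is good, with nothing left to play. *)
move=> k le Uk; apply: (ng k le).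
have [m Hm] := Uop t _ (q1q _ (q2q1 _ q2t)) Uk; exists m => u [q1u e]; apply: reach_now; apply: Hm.
by split=> //; apply: q1q.
Qed.

(** * Pieces of the payoff set and bad positions *)

Section Payoff.
Variable As : (nat -> bool) -> seq nat -> (nat -> vec F) -> Prop.
Implicit Types (s : seq nat).

Definition avoidI q Y x s := exists sigma, forall t Z, q t -> plays Y sigma x Z -> ~ As t s Z.

Lemma plays_le Y sigma sigma' x Z :
  (forall z, sigma z <= sigma' z) -> plays Y sigma' x Z -> plays Y sigma x Z.
Proof.
move=> le [bZ Zx H]; split=> // k /H[YZ aZ]; split=> //; exact: above_le aZ.
Qed.

(** By always playing at least [N], I forces II beyond the finite error of the almost inclusion. *)
Lemma plays_almost_le Y Y' : almost_le Y' Y ->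
  exists N, forall sigma x Z, plays Y' (fun z => maxn N (sigma z)) x Z -> plays Y sigma x Z.
Proof.
move=> [N HN]; exists N => sigma x Z [bZ Zx H]; split=> // k /H[YZ aZ]; split.
  by apply: HN => //; apply: above_le aZ; rewrite leq_maxl.
by apply: above_le aZ; rewrite leq_maxr.
Qed.

Lemma avoidI_le q q' Y Y' x s :
  subset_of q' q -> almost_le Y' Y -> avoidI q Y x s -> avoidI q' Y' x s.
Proof.
move=> sq /plays_almost_le[N HN] [sigma H].
by exists (fun z => maxn N (sigma z)) => t Z /sq qt /HN; apply: H.
Qed.

(** Larger moves of I only restrict II, so the pointwise maximum of the strategies for the finitely
    many nodes works for all of them. *)
Lemma avoidI_nodes q Y x s m :
  (forall t, q t -> avoidI (cyl q t m) Y x s) -> avoidI q Y x s.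
Proof.
move=> H.
have [|||||sigma [_ Hs]] := @all_nodes (seq (vec F) -> nat) (fun a b => forall z, a z <= b z) m
  (fun t sigma => forall t' Z, cyl q t m t' -> plays Y sigma x Z -> ~ As t' s Z) _ _ _ _ _ (fun=> 0).
- by [].
- by move=> b a c ab bc z; apply: leq_trans (bc z).
- by move=> t t' a e; rewrite (cyl_eq q e).
- by move=> t a b ab Ha t' Z ct' /(plays_le ab); apply: Ha.
- move=> t a; have [[t' [qt' e]]|nex] := classic (exists t', cyl q t m t'); last first.
    by exists a; split=> // t' Z ct'; case: nex; exists t'.
  have [b Hb] := H t' qt'; exists (fun z => maxn (a z) (b z)); split=> [z|u Z].
    exact: leq_maxl.
  rewrite (cyl_eq q e) => cu pZ; apply: Hb cu _; apply: plays_le pZ => z.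
  exact: leq_maxr.
by exists sigma => t Z qt; apply: Hs; apply: cyl_self.
Qed.

Definition code_pos (k : nat) : seq (vec F) * seq nat :=
  let c := odflt (0, [::]) (unpickle k : option (nat * seq nat)) in (code_vecs F c.1, c.2).

Lemma code_posE x s : coded x -> exists k, code_pos k = (x, s).
Proof. by move=> [j <-]; exists (pickle (j, s)); rewrite /code_pos pickleK. Qed.

Lemma code_pos_coded k : coded (code_pos k).1.
Proof. by exists (odflt (0, [::]) (unpickle k : option (nat * seq nat))).1. Qed.

Hypothesis As_extend : forall t s Z, As t s Z -> exists n, As t (rcons s n) Z.

(* I handles the set of index [rcons s n] from move number [n] on, hence only
   finitely many strategies have to be followed at each move. *)
Lemma avoidI_glue q Y Y' sigma x s : almost_le Y' Y ->
  (forall t Z, q t -> plays Y' sigma x Z ->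
     forall k n, size x < k -> avoidI q Y (mkseq Z k) (rcons s n)) ->
  avoidI q Y' x s.
Proof.
move=> le H.
have [sg Hsg] : exists sg : seq (vec F) * nat -> seq (vec F) -> nat, forall c,
    avoidI q Y c.1 (rcons s c.2) ->
    forall t Z, q t -> plays Y (sg c) c.1 Z -> ~ As t (rcons s c.2) Z.
  apply: (choice_fun (R := fun c sg => avoidI q Y c.1 (rcons s c.2) ->
    forall t Z, q t -> plays Y sg c.1 Z -> ~ As t (rcons s c.2) Z)) => c.
  by have [[sg Hsg]|no] := classic (avoidI q Y c.1 (rcons s c.2)); [exists sg|exists (fun=> 0)].
have [N HN] := plays_almost_le le.
pose glued z := \max_(j < (size z).+1) \max_(n < j.+1) sg (take j z, n : nat) z.
exists (fun z => maxn N (maxn (sigma z) (glued z))) => t Z qt pZ As_tZ.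
have pZ1 : plays Y' sigma x Z.
  by apply: plays_le pZ => z; rewrite !leq_max leqnn orbT.
have [n An] := As_extend As_tZ.
(* The strategy for digit [n] attached to [mkseq Z j] is among those followed from move [j] on,
   since [n <= j]; the hypothesis covers this position, which is longer than [x]. *)
pose j := maxn n (size x).+1.
have xj : size x < j by rewrite leq_maxr.
have [bZ Zx _] := pZ; have [_ _ HZ] := HN _ _ _ pZ.
have /= := Hsg (mkseq Z j, n) (H t Z qt pZ1 j n xj) t Z qt; case=> //.
split=> //=; first by rewrite size_mkseq.
rewrite size_mkseq => k lejk; have [YZ aZ] := HZ k (leq_trans (ltnW xj) lejk).
split=> //; apply: above_le aZ; rewrite leq_max; apply/orP; right.
have ltj : j < (size (mkseq Z k)).+1 by rewrite size_mkseq ltnS.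
have ltn : n < (Ordinal ltj).+1 by rewrite ltnS leq_maxl.
apply: leq_trans (leq_bigmax (Ordinal ltj)); apply: leq_trans (leq_bigmax (Ordinal ltn)).
by rewrite /= /mkseq -map_take take_iota (minn_idPl lejk).
Qed.

(** Bad means that [avoidI] fails on every neighbourhood of [t]. This is why the last property gives
    elements of [As] only at points [t'] arbitrarily close to [t]. *)
Lemma avoid_or_bad p X : perfect p -> block_seq X ->
  exists q Y, refines q Y p X /\ (avoidI q Y [::] [::] \/
    exists bad : (nat -> bool) -> seq (vec F) -> seq nat -> Prop, forall t, q t ->
      [/\ bad t [::] [::],
          forall x s, coded x -> bad t x s ->
            reach (fun z => [/\ size x < size z, coded z & exists n, bad t z (rcons s n)]) Y x &
          forall x s, coded x -> bad t x s ->
            forall m, exists t' Z, [/\ agree m t t', mkseq Z (size x) = x & As t' s Z]]).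
Proof.
move=> pp bX.
have [|k q1 Y1 q1X|q1 [Y1 [q1X dec]]] := @fusion F (fun k q Y =>
    avoidI q Y (code_pos k).1 (code_pos k).2 \/
    (forall q' Y', refines q' Y' q Y -> ~ avoidI q' Y' (code_pos k).1 (code_pos k).2)) p X _ pp bX _.
- move=> k r r' Z Z' rr' le [H|H]; [left; exact: avoidI_le H|right=> q' Y' [q'p q'r bY' Y'Z]].
  by apply: H; split=> //; [move=> t /q'r /rr'|apply: almost_le_trans Y'Z le].
- have [[q' [Y' [rY' H]]]|nex] := classic (exists q' Y', refines q' Y' q1 Y1 /\
      avoidI q' Y' (code_pos k).1 (code_pos k).2).
    by exists q', Y'; split=> //; left.
  exists q1, Y1; split; first by apply: refines_refl; case: q1X.
  by right=> q' Y' rY' av; apply: nex; exists q', Y'.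
have {}dec x s : coded x -> exists m, forall t, q1 t -> avoidI (cyl q1 t m) Y1 x s \/
    (forall q' Y', refines q' Y' (cyl q1 t m) Y1 -> ~ avoidI q' Y' x s).
  by move=> /(code_posE s)[k e]; have := dec k; rewrite e.
have [q1p q1q bY1 Y1X] := q1X.
pose good t x s := exists m, avoidI (cyl q1 t m) Y1 x s.
have decg x s : coded x -> exists m, forall t, q1 t -> avoidI (cyl q1 t m) Y1 x s \/
    (~ good t x s /\ forall q' Y', refines q' Y' (cyl q1 t m) Y1 -> ~ avoidI q' Y' x s).
  move=> /(dec _ s)[m Hm]; exists m => t q1t; have [av|no] := Hm t q1t; first by left.
  right; split=> // -[m' av]; apply: (no (cyl q1 t (maxn m m')) Y1).
    split=> //; [exact: perfect_cyl| |exact: almost_le_refl].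
    by apply: cyl_mono => //; apply: leq_maxl.
  by apply: avoidI_le av; [apply: cyl_mono => //; apply: leq_maxr|apply: almost_le_refl].
have [[t [q1t [m av]]]|nogood] := classic (exists t, q1 t /\ good t [::] [::]).
  by exists (cyl q1 t m), Y1; split; [apply: refines_cyl|left].
pose U x s t z := [/\ size x < size z, coded z & exists n, ~ good t z (rcons s n)].
have [|k q' Y' q'Y|q2 [Y2 [q2Y step]]] := @fusion F (fun k q Y =>
    (forall t, q t -> good t (code_pos k).1 (code_pos k).2) \/
    (forall t, q t -> reach (U (code_pos k).1 (code_pos k).2 t) Y (code_pos k).1)) q1 Y1 _ q1p bY1 _.
- move=> k r r' Z Z' rr' le [H|H]; [by left=> t /rr' /H|right=> t /rr' /H].
  exact: reach_le.
- have [q'p q'q1 bY' Y'Y] := q'Y; have [[t q't] _ _] := q'p.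
  have cx := code_pos_coded k; set x := (code_pos k).1 in cx *; set s := (code_pos k).2.
  have [m Hm] := decg x s cx.
  have rc : refines (cyl q' t m) Y' q' Y' by apply: refines_cyl => //; apply: refines_refl.
  have {Hm}[av|[ng no]] := Hm t (q'q1 _ q't).
    exists (cyl q' t m), Y'; split=> //; left=> u [_ e]; exists m.
    by rewrite -(cyl_eq q1 e).
  have [||q3 [Y3 [r3 alt]]] := @open_game (U x s) (cyl q' t m) Y' x _ bY' cx; first by case: rc.
    (* [U] is open because [decg] decides goodness on whole nodes. *)
    move=> u z [q'u _] [lt cz [n ngz]]; have [m' Hm'] := decg z (rcons s n) cz.
    exists m' => v [[q'v _] e]; split=> //; exists n.
    have [av|[_ no']] := Hm' u (q'q1 _ q'u); first by case: ngz; exists m'.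
    have [av|[]//] := Hm' v (q'q1 _ q'v).
    rewrite -(cyl_eq q1 e) in av; case: (no' (cyl q1 u m') Y1) => //.
    by apply: refines_refl => //; apply: perfect_cyl => //; apply: q'q1.
  have r3' := refines_trans r3 rc.
  exists q3, Y3; split=> //; case: alt => [|[sigma Hs]]; first by right.
  have [q3p q3c bY3 Y3Y'] := r3; have Y3Y := almost_le_trans Y3Y' Y'Y.
  have q3q1 : subset_of q3 q1 by move=> u /q3c[/q'q1].
  (* Here I can stay among positions all of whose one-digit extensions are good; gluing the
     strategies attached to them contradicts [no]. *)
  case: (no q3 Y3); first by split=> // u /q3c; apply: cyl_mono.
  apply: (@avoidI_glue q3 Y1 Y3 sigma) => // u Z q3u pZ k' n lt.
  have [bZ Zx _] := pZ; have cz := coded_mkseq k' bZ.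
  have [m' Hm'] := decg _ (rcons s n) cz.
  apply: (@avoidI_nodes _ _ _ _ m') => v q3v.
  have [av|[ngz _]] := Hm' v (q3q1 _ q3v).
    by apply: avoidI_le av; [apply: cyl_mono|apply: almost_le_refl].
  case: (Hs v Z q3v pZ k' (ltnW lt)); split=> //; first by rewrite size_mkseq.
  by exists n.
have [q2p q2q1 bY2 Y2Y] := q2Y.
exists q2, Y2; split; first exact: refines_trans q2Y q1X.
right; exists (fun t x s => ~ good t x s) => t q2t; have q1t := q2q1 _ q2t; split.
- by move=> g; apply: nogood; exists t.
- move=> x s /(code_posE s)[k e] ng; have [m /(_ t q2t)] := step k; rewrite e /=.
  by case=> [/(_ t (cyl_self _ q2t))//|/(_ t (cyl_self _ q2t))].
(* If [As] had no such element near [t], the constant strategy [0] would avoid it there. *)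
- move=> x s cx ng m; apply: NNPP => nex; apply: ng; exists m, (fun=> 0) => t' Z [_ e] [_ Zx _] At'.
  by apply: nex; exists t', Z.
Qed.

End Payoff.

(** * Concatenation of the strategies of player II *)

Section ComposeII.
Variables (Y : nat -> vec F) (B : seq (vec F) -> seq nat -> Prop).
Implicit Types (s : seq nat).

Hypothesis B_nil : B [::] [::].
Let U x s z := [/\ size x < size z, coded z & exists n, B z (rcons s n)].
Hypothesis B_reach : forall x s, coded x -> B x s -> reach (U x s) Y x.

(** The target demands a longer position than [x], so at least one move remains to be played. *)
Lemma B_start x s : coded x -> B x s -> exists T, wins (U x s) Y T x /\ T <> Done.
Proof.
move=> cx Bx; have [T wT] := B_reach cx Bx; exists T; split=> // eT.
by move: wT; rewrite eT /= => -[]; rewrite ltnn.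
Qed.

Lemma II_composition : exists tau : seq (nat -> vec F) -> vec F,
  forall Ys, (forall k, block_seq (Ys k) /\ almost_le (Ys k) Y) ->
  let y k := tau (mkseq Ys k.+1) in
  [/\ forall k, in_span (Ys k) (y k), block_seq y &
      exists a : nat -> nat, forall j, exists k, j <= k /\ B (mkseq y k) (mkseq a j)].
Proof.
(* A state holds the current position, the position where the current phase began, the digits found
   so far and the rest of the current strategy. When the latter ends, a digit is added and a new
   phase begins. *)
pose S := (seq (vec F) * seq (vec F) * seq nat * strat)%type.
pose sx (c : S) := c.1.1.1; pose s0 (c : S) := c.1.1.2; pose ss (c : S) := c.1.2.
pose P (c : S) := [/\ coded (sx c), wins (U (s0 c) (ss c)) Y c.2 (sx c), c.2 <> Done &
  size (ss c) <= size (s0 c)].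
pose legal V := block_seq V /\ almost_le V Y.
pose R (c : S) V (c' : S) := exists y,
  [/\ sx c' = rcons (sx c) y, in_span V y, nonzero y /\ fits (sx c) y &
   (exists f g, [/\ c.2 = Move f g, c'.2 = g V & ss c' = ss c]) \/
   (exists n, [/\ ss c' = rcons (ss c) n, size (ss c') <= size (sx c') & B (sx c') (ss c')])].
have [nx Hnx] : exists nx : S * (nat -> vec F) -> S, forall cV, P cV.1 -> legal cV.2 ->
    P (nx cV) /\ R cV.1 cV.2 (nx cV).
  apply: (choice_fun (R := fun cV c' => P cV.1 -> legal cV.2 -> P c' /\ R cV.1 cV.2 c')).
  move=> [[[[x x0] s] T] V] /=.
  have [[Pc [bV VY]]|no] := classic (P (x, x0, s, T) /\ legal V); last first.
    by exists (x, x0, s, T) => Pc lV; case: no.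
  case: Pc; rewrite /sx /s0 /ss /= => cx; case: T => [//|f g] /(_ V bV VY)[Vf nf ff wg] _ ls.
  have cx' := coded_rcons cx (in_span_finsupp bV Vf).
  case eg : (g V) wg => [|f' g'] wg.
    case: (wg) => lt _ [n Bn]; have [T' [wT' nT']] := B_start cx' Bn.
    have ls' : size (rcons s n) <= size (rcons x (f V)).
      by rewrite size_rcons; apply: leq_ltn_trans lt.
    exists (rcons x (f V), rcons x (f V), rcons s n, T') => _ _; split=> //.
    by exists (f V); split=> //; right; exists n.
  exists (rcons x (f V), x0, s, g V) => _ _; split; first by split=> //; rewrite eg.
  by exists (f V); split=> //; left; exists f, g.
have [T [wT nT]] := B_start (coded_nil F) B_nil.
pose c0 : S := ([::], [::], [::], T).
pose run l := foldl (fun c V => nx (c, V)) c0 l.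
exists (fun l => last (zero_vec F) (sx (run l))) => Ys HYs y.
pose st k := run (mkseq Ys k).
have stS k : st k.+1 = nx (st k, Ys k) by rewrite /st mkseqS /run foldl_rcons.
have HP k : P (st k).
  elim: k => [|k IH]; first by split=> //; apply: coded_nil.
  by rewrite stS; apply: (proj1 (Hnx (_, _) IH (HYs k))).
have HR k : R (st k) (Ys k) (st k.+1) by rewrite stS; apply: (proj2 (Hnx (_, _) (HP k) (HYs k))).
have stx k : sx (st k) = mkseq y k.
  elim: k => [//|k IH]; have [w [e _ _ _]] := HR k.
  by rewrite mkseqS -IH /y -/(st _) e last_rcons.
have yE k : in_span (Ys k) (y k) /\ nonzero (y k) /\ fits (mkseq y k) (y k).
  have [w [e Yw [nw fw] _]] := HR k; rewrite -stx.
  by rewrite /y -/(st k.+1) e last_rcons.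
split.
- by move=> k; have [] := yE k.
- move=> k; have [Yk [nk _]] := yE k; split; first by apply: in_span_finsupp Yk; have [] := HYs k.
  by split=> //; have [_ [_]] := yE k.+1; rewrite /fits mkseqS last_rcons.
have ssS k : ss (st k.+1) = ss (st k) \/ exists n, ss (st k.+1) = rcons (ss (st k)) n.
  by have [w [_ _ _ [[f [g [_ _]]]|[n [e _ _]]]]] := HR k; [left|right; exists n].
(* Each phase ends, by induction on the well-founded strategy tree that remains. *)
have progress k : exists k', [/\ size (ss (st k')) = (size (ss (st k))).+1,
    size (ss (st k')) <= k' & B (sx (st k')) (ss (st k'))].
  have : exists T, (st k).2 = T by exists (st k).2.
  case=> T' eT'; elim: T' k eT' => [|f g IH] k eT'; first by have [] := HP k.
  have [w [_ _ _ [[f' [g' [e1 e2 <-]]]|[n [e le Bn]]]]] := HR k.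
    by move: e1 e2; rewrite eT' => -[_ <-] /IH.
  exists k.+1; split=> //; first by rewrite e size_rcons.
  by move: le; rewrite stx size_mkseq.
have reached j : exists k, [/\ size (ss (st k)) = j, j <= k & B (sx (st k)) (ss (st k))].
  elim: j => [|j [k [e _ _]]]; first by exists 0.
  by have [k'] := progress k; rewrite e => -[e' le Bk]; exists k'; rewrite -{2}e'.
have ss_pre k l i : k <= l -> i < size (ss (st k)) ->
    nth 0 (ss (st l)) i = nth 0 (ss (st k)) i /\ i < size (ss (st l)).
  elim: l => [|l IH]; first by rewrite leqn0 => /eqP->.
  rewrite leq_eqVlt => /orP[/eqP-> //|]; rewrite ltnS => le lt.
  have [e lti] := IH le lt; case: (ssS l) => [->|[n ->]] //.
  by rewrite nth_rcons size_rcons lti ltnS ltnW.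
have [K HK] := choice_fun reached.
(* Digit [j] is read at a stage where [j.+1] digits are known; by [ss_pre] later stages do not
   change it. *)
exists (fun j => nth 0 (ss (st (K j.+1))) j) => j.
have [sK le BK] := HK j; exists (K j); split=> //.
rewrite -stx; set a := mkseq _ _; suff -> : a = ss (st (K j)) by [].
apply: (@eq_from_nth _ 0); first by rewrite size_mkseq.
move=> i; rewrite size_mkseq => lt; rewrite nth_mkseq //.
have [sKi _ _] := HK i.+1.
have [le'|le'] := leqP (K i.+1) (K j).
  by have [|-> //] := @ss_pre _ _ i le'; rewrite sKi.
by have [|-> //] := @ss_pre _ _ i (ltnW le'); rewrite sK.
Qed.

End ComposeII.
End Games.

(** * Transfer to the reals *)

Section CantorMap.
Local Open Scope R_scope.

(** Partial sums of the ternary expansion with digits 0 and 2, which parametrizes the Cantor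
    middle-thirds set. *)
Fixpoint ternary (t : nat -> bool) (n : nat) : R :=
  if n is m.+1 then ternary t m + (if t m then 2 else 0) * (/ 3) ^ m.+1 else 0.

Lemma third_gt0 n : 0 < (/ 3) ^ n.
Proof. by apply: pow_lt; lra. Qed.

Lemma thirdS n : (/ 3) ^ n.+1 = (/ 3) ^ n / 3.
Proof. by rewrite /=; field. Qed.

Lemma third_le m n : (m <= n)%N -> (/ 3) ^ n <= (/ 3) ^ m.
Proof.
move=> /subnKC <-; elim: (n - m)%N => [|k IH]; first by rewrite addn0; lra.
by rewrite addnS thirdS; have := third_gt0 (m + k); lra.
Qed.

Lemma third_small eps : 0 < eps -> exists n, (/ 3) ^ n < eps.
Proof.
move=> eps0; have [|N HN] := pow_lt_1_zero (/ 3) _ eps eps0; first by rewrite Rabs_right; lra.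
by exists N; have := HN N (le_n _); rewrite Rabs_right //; apply/Rle_ge/Rlt_le/third_gt0.
Qed.

Lemma ternary_bounds t n k :
  ternary t n <= ternary t (n + k) /\
  ternary t (n + k) + (/ 3) ^ (n + k) <= ternary t n + (/ 3) ^ n.
Proof.
elim: k => [|k [IH1 IH2]]; first by rewrite addn0; lra.
by rewrite addnS /= -!/((/ 3) ^ _.+1) thirdS; have := third_gt0 (n + k); case: (t _); lra.
Qed.

Lemma ternary_agree t t' n : agree n t t' -> ternary t n = ternary t' n.
Proof.
elim: n => //= n IH a; rewrite IH; last exact: agree_le a.
by rewrite (a n).
Qed.

(** Different digits at place [n] move the partial sums apart by twice [(/ 3) ^ n.+1], and the
    remaining digits recover at most half of this gap. *)
Lemma cantor_map : exists h : (nat -> bool) -> R,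
  (forall t t' n, agree n t t' -> Rabs (h t - h t') <= (/ 3) ^ n) /\
  (forall t t' n, agree n t t' -> t n <> t' n -> (/ 3) ^ n.+1 <= Rabs (h t - h t')).
Proof.
have [h Hh] : exists h : (nat -> bool) -> R,
    forall t n, ternary t n <= h t <= ternary t n + (/ 3) ^ n.
  apply: (choice_fun (R := fun t x => forall n, ternary t n <= x <= ternary t n + (/ 3) ^ n)) => t.
  have ub n m : ternary t m <= ternary t n + (/ 3) ^ n.
    case: (leqP m n) => [/subnKC <-|/ltnW /subnKC <-].
      by have [H _] := ternary_bounds t m (n - m); have := third_gt0 (m + (n - m)); lra.
    by have [_ H] := ternary_bounds t n (m - n); have := third_gt0 (n + (m - n)); lra.
  have [||x [x1 x2]] := completeness (fun x => exists n, x = ternary t n).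
  - by exists (ternary t 0 + (/ 3) ^ 0) => _ [n ->]; apply: ub.
  - by exists (ternary t 0), 0%N.
  exists x => n; split; first by apply: x1; exists n.
  by apply: x2 => _ [m ->]; apply: ub.
exists h; split=> t t' n a.
  have := Hh t n; have := Hh t' n; rewrite (ternary_agree a) => ? ?.
  by apply: Rabs_le; lra.
have := Hh t n.+1; have := Hh t' n.+1; rewrite /= -!/((/ 3) ^ _.+1) (ternary_agree a) thirdS.
have := third_gt0 n; case: (t n); case: (t' n) => // ? ? ? _.
  by rewrite Rabs_right; lra.
by rewrite Rabs_left; lra.
Qed.

Lemma first_difference n t t' : ~ agree n t t' ->
  exists i, [/\ (i < n)%N, agree i t t' & t i <> t' i].
Proof.
elim: n => [|n IH] na; first by case: na => i; rewrite ltn0.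
have [a|/IH[i [lt a d]]] := classic (agree n t t'); last by exists i; split=> //; apply: ltnW.
exists n; split=> // e; apply: na => i; rewrite ltnS leq_eqVlt => /orP[/eqP-> //|]; exact: a.
Qed.

Lemma perfect_image (h : (nat -> bool) -> R) q :
  (forall t t' n, agree n t t' -> Rabs (h t - h t') <= (/ 3) ^ n) ->
  (forall t t' n, agree n t t' -> t n <> t' n -> (/ 3) ^ n.+1 <= Rabs (h t - h t')) ->
  perfect q -> nonempty_perfect (fun x => exists t, q t /\ h t = x).
Proof.
move=> hup hlow [[t0 qt0] qcl qsp]; split; last split.
- by exists (h t0), t0.
- move=> x Hx.
  (* Half of [(/ 3) ^ n.+1] is chosen so that [ts n] and every later [ts m] have images too close to
     differ at any bit up to [n]. *)
  have [ts Hts] : exists ts : nat -> nat -> bool,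
      forall n, q (ts n) /\ Rabs (h (ts n) - x) < (/ 3) ^ n.+1 / 2.
    apply: (choice_fun (R := fun n t => q t /\ Rabs (h t - x) < (/ 3) ^ n.+1 / 2)) => n.
    have [|_ [[t [qt <-]] H]] := Hx ((/ 3) ^ n.+1 / 2); first by have := third_gt0 n.+1; lra.
    by exists t.
  have ag n m : (n <= m)%N -> agree n.+1 (ts n) (ts m).
    move=> le; apply: NNPP => /first_difference[i [lti a d]].
    have := hlow _ _ _ a d; have := third_le lti; have := third_le (n := m.+1) (m := n.+1) le.
    have [_] := Hts n; have [_] := Hts m.
    have -> : h (ts n) - h (ts m) = (h (ts n) - x) - (h (ts m) - x) by ring.
    have := Rabs_triang (h (ts n) - x) (- (h (ts m) - x)); rewrite Rabs_Ropp /Rminus.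
    by lra.
  pose v i := ts i i.
  have av n : agree n v (ts n) by move=> i lt; apply: (ag i n (ltnW lt) i).
  exists v; split; first by apply: qcl => n; exists (ts n); split=> //; case: (Hts n).
  apply: NNPP => ne.
  have pos : 0 < Rabs (h v - x) by apply: Rabs_pos_lt; lra.
  have [|n Hn] := @third_small (Rabs (h v - x) / 2); first by lra.
  have [_ H] := Hts n; have H' := hup _ _ _ (av n).
  have := Rabs_triang (h v - h (ts n)) (h (ts n) - x); have := third_gt0 n.
  have -> : h v - h (ts n) + (h (ts n) - x) = h v - x by ring.
  by move: H; rewrite thirdS; lra.
- move=> _ [t [qt <-]] eps /third_small[n Hn].
  have [t' [qt' a [i d]]] := qsp t qt n.
  exists (h t'); split; first by exists t'.
  split; last first.
    by rewrite Rabs_minus_sym; have := hup _ _ _ a; lra.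
  have [|j [_ a' d']] := @first_difference i.+1 t t'; first by move=> /(_ i (ltnSn i)).
  move=> e; have := hlow _ _ _ a' d'; rewrite e Rminus_diag Rabs_R0.
  by have := third_gt0 j.+1; lra.
Qed.

(** The graph of [f] is closed: it suffices to find, arbitrarily close to [a], points whose images
    are arbitrarily close to [(x, y)]. *)
Lemma baire_continuous_limit (T : Type) (f : (nat -> nat) -> R * (nat -> T)) a x y :
  baire_continuous f ->
  (forall m n eps, 0 < eps -> exists b, [/\ forall i, (i < m)%N -> b i = a i,
     Rabs (x - fst (f b)) < eps & forall i, (i < n)%N -> snd (f b) i = y i]) ->
  f a = (x, y).
Proof.
move=> fcont H.
have close eps n : 0 < eps -> Rabs (x - fst (f a)) < eps /\
    forall i, (i < n)%N -> snd (f a) i = y i.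
  move=> eps0; have eps2 : 0 < eps / 2 by lra.
  have [m Hm] := fcont a (eps / 2) n eps2.
  have [b [ba xb yb]] := H m n _ eps2; have [H1 H2] := Hm b ba.
  split; last by move=> i lti; rewrite -H2 // yb.
  have := Rabs_triang (x - fst (f b)) (fst (f b) - fst (f a)).
  have -> : x - fst (f b) + (fst (f b) - fst (f a)) = x - fst (f a) by ring.
  by lra.
rewrite [LHS]surjective_pairing; congr pair.
  apply: NNPP => ne; have pos : 0 < Rabs (x - fst (f a)) by apply: Rabs_pos_lt; lra.
  by have [] := close _ 0%N pos; lra.
apply: functional_extensionality => i.
by have [|_ ->] := close 1 i.+1; first by lra.
Qed.

End CantorMap.

Lemma perfect_full : perfect (fun _ => True).
Proof.
split=> // [|t _ n]; first by exists (fun=> true).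
exists (fun i => if i == n then ~~ t i else t i); split=> //.
  by move=> i lt; rewrite ltn_eqF.
by exists n; rewrite eqxx; case: (t n).
Qed.

Lemma basis_block (F : countFieldType) : block_seq (fun k i => ((i == k)%:R : F)%R).
Proof.
have supp k i : ((i == k)%:R != 0 :> F)%R -> i = k by case: (i =P k) => // _; rewrite eqxx.
move=> k; split; first by exists k.+1 => n lt; rewrite gtn_eqF.
split; first by exists k; rewrite eqxx GRing.oner_neq0.
by move=> i j /supp-> /supp->.
Qed.

Theorem theorem1p7 (F : countFieldType) (A : R * (nat -> vec F) -> Prop) :
  (forall p, A p -> block_seq (snd p)) ->
  analytic A ->
  exists (P : R -> Prop) (X : nat -> vec F),
    nonempty_perfect P /\ block_seq X /\
    ((exists sigma : seq (vec F) -> nat,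
        forall t Y, P t -> asym_outcomes X sigma Y -> ~ A (t, Y)) \/
     (forall t, P t -> II_gowers_into X (fun Y => A (t, Y)))).
Proof.
move=> _ anA; have [h [hup hlow]] := cantor_map.
case: anA => [A0|[f [fcont fA]]].
  exists (fun x => exists t, True /\ h t = x), (fun k i => ((i == k)%:R : F)%R).
  split; first exact: perfect_image perfect_full.
  by split; [apply: basis_block|left; exists (fun=> 0)].
pose As t s Z := exists a, mkseq a (size s) = s /\ f a = (h t, Z).
have As_extend t s Z : As t s Z -> exists n, As t (rcons s n) Z.
  by move=> [a [e fa]]; exists (a (size s)), a; rewrite size_rcons mkseqS e.
have [q [Y [[qp _ bY _] alt]]] := avoid_or_bad As_extend perfect_full (basis_block F).
exists (fun x => exists t, q t /\ h t = x), Y.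
split; first exact: perfect_image qp.
split=> //; case: alt => [[sigma Hs]|[bad Hbad]].
  left; exists sigma => _ Z [t [qt <-]] [bZ [YZ aZ]] /fA[a fa].
  by apply: (Hs t Z qt); [split|exists a].
right=> _ [t [qt <-]]; have [bad0 bad_reach bad_As] := Hbad t qt.
have [tau Htau] := II_composition bad0 bad_reach.
exists tau => Ys HYs; set y := fun k => _.
have [|Yy by_ [a Ha]] := Htau Ys.
  by move=> k; have [bYk YkY] := HYs k; split=> //; apply: almost_le_preceq.
split=> //; split=> //.
(* The digits [a] are a witness: the bad position after [k] moves yields [b] sharing many digits
   with [a], whose image is [h t'] for some [t'] near [t] together with a sequence that begins like
   [y]. *)
apply/fA; exists a; apply: baire_continuous_limit => // m n eps /third_small[M HM].
have [k [le Bk]] := Ha (maxn m n).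
have [t' [Z [tt' Zy [b [eb fb]]]]] := bad_As _ _ (coded_mkseq k by_) Bk M.
rewrite size_mkseq in Zy; rewrite size_mkseq in eb.
exists b; rewrite fb; split=> [i lti||i lti] /=.
- have lt : i < maxn m n by apply: leq_trans lti (leq_maxl _ _).
  by have := congr1 (fun s => nth 0 s i) eb; rewrite !nth_mkseq.
- exact: Rle_lt_trans (hup _ _ _ tt') HM.
- have ltk : i < k by apply: leq_trans le; apply: leq_trans lti (leq_maxr _ _).
  by have := congr1 (fun s => nth (zero_vec F) s i) Zy; rewrite !nth_mkseq.
Qed.
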